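(* Let $(a,b)\subseteq\mathbb{R}$ be a bounded open interval and $Q,m\ge 1$ integers. Let $f_n \to f$ in $W^{1,p}((a,b),\mathcal{A}_Q(\mathbb{R}^m))$ for some $p>1$ or, alternatively, let $f_n \to f$ in $W^{1,1}((a,b),\mathcal{A}_Q(\mathbb{R}^m))$ and $f_n(x_0) \to f(x_0)$ for some $x_0 \in [a,b]$. Fix $\epsilon>0$ and an Almgren embedding $\Delta : \mathcal{A}_Q(\mathbb{R}^m) \to \mathbb{R}^N$, and let $t := t_{\epsilon,\Delta \circ f}$ and $t_n := t_{\epsilon,\Delta \circ f_n}$ be the reparameterizations defined in the context. Then $t_n \to t$ in $W^{1,q}_{\mathrm{loc}}(\mathbb{R})$ and $f_n \circ t_n \to f\circ t$ in $W^{1,q}_{\mathrm{loc}}(\mathbb{R},\mathcal{A}_Q(\mathbb{R}^m))$, for all $q \in[1,\infty)$.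
   Context: $\mathcal{A}_Q(\mathbb{R}^m)$ is the set of unordered $Q$-tuples of points of $\mathbb{R}^m$ with multiplicities, written $\sum_{i=1}^Q [\![p_i]\!]$ (sums of Dirac masses), with the complete metric $\mathbf{d}_2\big(\sum_i [\![p_i]\!],\sum_i [\![q_i]\!]\big) := \min_{\sigma \in \mathrm{S}_Q} \big(\sum_{i=1}^Q \|p_i - q_{\sigma(i)}\|_2^2\big)^{1/2}$. Almgren embedding: an injective Lipschitz map $\Delta : \mathcal{A}_Q(\mathbb{R}^m) \to \mathbb{R}^N$, $N=N(m,Q)$, with $\mathrm{Lip}(\Delta) \le 1$ whose inverse on $\Delta(\mathcal{A}_Q(\mathbb{R}^m))$ is Lipschitz with constant bounded by a constant $C(m,Q)$; moreover there is a Lipschitz retraction of $\mathbb{R}^N$ onto $\Delta(\mathcal{A}_Q(\mathbb{R}^m))$. Such maps exist (Almgren). Sobolev spaces: for an open interval $J$ and $q \in [1,\infty)$, $W^{1,q}(J,\mathcal{A}_Q(\mathbb{R}^m)) := \{f : J \to \mathcal{A}_Q(\mathbb{R}^m) : \Delta \circ f \in W^{1,q}(J,\mathbb{R}^N)\}$, with the metric $(f,g) \mapsto \|\Delta \circ f - \Delta \circ g\|_{W^{1,q}(J,\mathbb{R}^N)}$ (functions equal almost everywhere are identified); the induced topology does not depend on the choice of Almgren embedding. Elements of $W^{1,q}((a,b),\mathcal{A}_Q(\mathbb{R}^m))$ are identified with their absolutely continuous representatives and extended continuously to $[a,b]$. Convergence in $W^{1,q}_{\mathrm{loc}}$ on $\mathbb{R}$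 means $W^{1,q}$ convergence on every bounded open interval. Reparameterization: for $\epsilon>0$ and an absolutely continuous $g \in W^{1,1}((a,b),\mathbb{R}^N)$, let $s_{\epsilon,g}(x) := \int_a^x (\epsilon + \|g'(u)\|_2)\,du$ for $x \in [a,b]$ and $L := s_{\epsilon,g}(b)$. Then $s_{\epsilon,g} : [a,b]\to[0,L]$ is a strictly increasing bijection; $t_{\epsilon,g} : \mathbb{R} \to [a,b]$ is defined as $s_{\epsilon,g}^{-1}$ on $[0,L]$, as $a$ on $(-\infty,0)$, and as $b$ on $(L,\infty)$. *)

(* Defs.v *)
From HB Require Import structures.
From mathcomp Require Import all_boot all_order all_algebra all_fingroup.
From mathcomp Require Import generic_quotient.
From mathcomp Require Import all_classical all_reals all_analysis.

Set Implicit Arguments.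
Unset Strict Implicit.
Unset Printing Implicit Defensive.
Import Order.TTheory GRing.Theory Num.Theory.
Import numFieldNormedType.Exports.
Local Open Scope classical_set_scope.
Local Open Scope ring_scope.

(* The library norm on row vectors is the sup norm, hence this definition. *)
Definition enorm (R : realType) (N : nat) (x : 'rV[R]_N) : R :=
  Num.sqrt (\sum_(i < N) x 0 i ^+ 2).

Section AQ.
Context (R : realType) (Q m : nat).

Definition tperm_eq (s t : Q.-tuple 'rV[R]_m) : bool := perm_eq s t.

Lemma tperm_eq_equiv : equiv_class_of tperm_eq.
Proof.
split=> [s|s t|t s u]; rewrite /tperm_eq; first exact: perm_refl.
  by rewrite perm_sym.
exact: perm_trans.
Qed.

Canonical tperm_eq_equivRel := EquivRelPack tperm_eq_equiv.

(* [\pi_AQ [tuple p_1; ...; p_Q]] is the sum of Dirac masses at the p_i. *)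
Definition AQ := {eq_quot tperm_eq}%qT.

Definition match_cost (s t : Q.-tuple 'rV[R]_m) (sigma : 'S_Q) : R :=
  Num.sqrt (\sum_(i < Q) enorm (tnth s i - tnth t (sigma i)) ^+ 2).

(* The index of the big operator is itself one of the costs, so that this is
   the minimum over 'S_Q. *)
Definition tuple_d2 (s t : Q.-tuple 'rV[R]_m) : R :=
  \big[Order.min/match_cost s t 1%g]_(sigma : 'S_Q) match_cost s t sigma.

Definition d2 (S T : AQ) : R := tuple_d2 (repr S) (repr T).

Lemma le_tuple_d2P (s t : Q.-tuple 'rV[R]_m) (c : R) :
  reflect (forall sigma, c <= match_cost s t sigma) (c <= tuple_d2 s t).
Proof.
apply: (iffP idP) => [cd sigma|cm].
  apply: le_trans cd _; exact: bigmin_le_cond.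
by apply/bigmin_geP; split => // sigma _; exact: cm.
Qed.

Lemma d2_pi (s t : Q.-tuple 'rV[R]_m) :
  d2 (\pi_AQ s)%qT (\pi_AQ t)%qT = tuple_d2 s t.
Proof.
suff H s1 s2 t1 t2 : tperm_eq s1 s2 -> tperm_eq t1 t2 ->
    tuple_d2 s1 t1 <= tuple_d2 s2 t2.
  have E u : tperm_eq (repr (\pi_AQ u)%qT) u.
    by apply/eqmodP; rewrite reprK.
  have E' u : tperm_eq u (repr (\pi_AQ u)%qT).
    by rewrite /tperm_eq perm_sym; exact: E.
  by apply/eqP; rewrite eq_le; apply/andP; split; apply: H.
move=> /tuple_permP[a Ea] /tuple_permP[b Eb].
have {}Ea i : tnth s1 i = tnth s2 (a i).
  have -> : s1 = [tuple tnth s2 (a i) | i < Q] by exact: val_inj.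
  by rewrite tnth_mktuple.
have {}Eb i : tnth t1 i = tnth t2 (b i).
  have -> : t1 = [tuple tnth t2 (b i) | i < Q] by exact: val_inj.
  by rewrite tnth_mktuple.
apply/le_tuple_d2P => sigma.
have -> : match_cost s2 t2 sigma = match_cost s1 t1 (a * sigma * b^-1)%g.
  rewrite /match_cost (reindex_inj (@perm_inj _ a)) /=; congr Num.sqrt.
  apply: eq_bigr => i _.
  by rewrite Ea Eb !permM permKV.
by move: (a * sigma * b^-1)%g; exact/le_tuple_d2P.
Qed.

Definition almgren_embedding (N : nat) (Delta : AQ -> 'rV[R]_N) : Prop :=
  [/\ injective Delta,
      (forall S T, enorm (Delta S - Delta T) <= d2 S T),
      (exists C : R, forall S T, d2 S T <= C * enorm (Delta S - Delta T)) &
      (exists (rho : 'rV[R]_N -> 'rV[R]_N) (K : R),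
         [/\ range rho = range Delta,
             (forall z, range Delta z -> rho z = z) &
             (forall x y, enorm (rho x - rho y) <= K * enorm (x - y))])].

End AQ.

Section Sobolev.
Context (R : realType) (N : nat).
Notation mu := (@lebesgue_measure R).
Implicit Types (J : set R) (q : R) (u v : R -> 'rV[R]_N).

Definition test_function J (phi : R -> R) : Prop :=
  [/\ (forall n x, derivable (derive1n n phi) x 1),
      compact (closure [set x | phi x != 0]) &
      closure [set x | phi x != 0] `<=` J].

Definition is_weak_deriv J u v : Prop :=
  forall i : 'I_N, locally_integrable J (fun x => v x 0 i) /\
    forall phi, test_function J phi ->
      \int[mu]_(x in J) (u x 0 i * derive1 phi x) =
      - \int[mu]_(x in J) (v x 0 i * phi x).

(* Unique up to equality almost everywhere on J, when it exists. *)
Definition weak_deriv J u : R -> 'rV[R]_N := xget (cst 0) (is_weak_deriv J u).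

Definition Lq_norm J q u : \bar R :=
  'N[mu]_(q%:E)[(fun x => (enorm (u x))%:E) \_ J]%E.

Definition in_Lq J q u : Prop :=
  (forall i, measurable_fun J (fun x => u x 0 i)) /\ (Lq_norm J q u < +oo)%E.

Definition in_W1q J q u : Prop :=
  in_Lq J q u /\ exists2 v, is_weak_deriv J u v & in_Lq J q v.

(* The sum of the two L^q norms; the q-th root of the sum of the q-th powers is
   an equivalent choice and yields the same convergence. *)
Definition W1q_norm J q u : \bar R :=
  (Lq_norm J q u + Lq_norm J q (weak_deriv J u))%E.

Definition W1q_cvg J q (u_ : nat -> R -> 'rV[R]_N) u : Prop :=
  [/\ (forall n, in_W1q J q (u_ n)), in_W1q J q u &
      W1q_norm J q (fun x => u_ n x - u x) @[n --> \oo] --> 0%E].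

Definition W1q_loc_cvg q (u_ : nat -> R -> 'rV[R]_N) u : Prop :=
  forall c d : R, c < d -> W1q_cvg `]c, d[%classic q u_ u.

End Sobolev.

(* Real-valued functions are the case N = 1 of the spaces above. *)
Definition real_rV (R : realType) (g : R -> R) (x : R) : 'rV[R]_1 :=
  const_mx (g x).

Section SobolevAQ.
Context (R : realType) (Q m N : nat) (Delta : AQ R Q m -> 'rV[R]_N).

(* W^{1,q}(J, A_Q) and its metric are those transported by the embedding
   Delta. *)
Definition AQ_W1q_cvg (J : set R) (q : R)
    (f_ : nat -> R -> AQ R Q m) (f : R -> AQ R Q m) : Prop :=
  W1q_cvg J q (fun n => Delta \o f_ n) (Delta \o f).

Definition AQ_W1q_loc_cvg (q : R)
    (f_ : nat -> R -> AQ R Q m) (f : R -> AQ R Q m) : Prop :=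
  W1q_loc_cvg q (fun n => Delta \o f_ n) (Delta \o f).

(* The usual epsilon-delta condition, for finite families of pairwise
   non-overlapping subintervals [l i, r i] of [a, b]. *)
Definition AQ_abs_continuous (a b : R) (f : R -> AQ R Q m) : Prop :=
  forall e : R, 0 < e -> exists2 d : R, 0 < d &
    forall (k : nat) (l r : 'I_k -> R),
      (forall i, a <= l i /\ l i <= r i /\ r i <= b) ->
      trivIset [set: 'I_k] (fun i => `]l i, r i[%classic) ->
      \sum_(i < k) (r i - l i) < d ->
      \sum_(i < k) d2 (f (l i)) (f (r i)) < e.

End SobolevAQ.

Section reparameterization.
Context (R : realType) (N : nat) (a b eps : R) (g : R -> 'rV[R]_N).
Notation mu := (@lebesgue_measure R).

(* The derivative of g lives on the open interval, whence ]a, x[. *)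
Definition arc_s (x : R) : R :=
  \int[mu]_(u in `]a, x[) (eps + enorm (weak_deriv `]a, b[ g u)).

Definition arc_t (y : R) : R :=
  if y < 0 then a
  else if arc_s b < y then b
  else xget a [set x | x \in `[a, b] /\ arc_s x = y].

End reparameterization.

(* Main.v *)
Require Import Defs.
From HB Require Import structures.
From mathcomp Require Import all_boot all_order all_algebra all_fingroup.
From mathcomp Require Import all_classical all_reals all_analysis.
From mathcomp Require Import measurable_realfun ring lra.
Import Order.TTheory GRing.Theory Num.Theory.
Import numFieldNormedType.Exports.
Local Open Scope classical_set_scope.
Local Open Scope ring_scope.
Set Implicit Arguments.
Unset Strict Implicit.
Unset Printing Implicit Defensive.

(** Put F = Delta o f and let v be the weak derivative of F.  The arc length s
   of the reparameterization has density g = eps + |v|, so its inverse t is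
   1/eps-Lipschitz, and on ]0, L[
     t' = (1 / g) o t,        (F o t)' = (v / g) o t,
   while both derivatives vanish outside [0, L].  These rates are bounded, by
   1/eps and by 1, whatever the integrability of v.  For sequences with
   uniformly bounded rates, W^{1,q} convergence on bounded intervals follows, for
   all finite q at once, from uniform convergence of the functions and L^1
   convergence of the rates ([W1q_loc_cvg_bounded_rate]).  L^p convergence on
   a bounded interval implies L^1 convergence ([Lq_to_L1]), and the rest of the
   argument starts from W^{1,1} convergence of the curves.

   Uniform convergence.  The distance between s_n and s is at most the L^1
   distance between g_n and g, and arc length expands distances by at least eps,
   so t_n is uniformly close to t ([arc_inv_cvg]).  A curve that converges in
   W^{1,1} converges uniformly ([curve_cvg]), and F varies by at most the
   variation of s, whence F_n o t_n converges uniformly ([arc_comp_cvg]).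

   L^1 convergence of the rates (w_n / g_n) o t_n ([arc_rate_cvg]).  The
   substitution x = t_n y turns dy into g_n dx ([arc_change_of_variables]).  Hence
   if rho is continuous, the L^1 distance between (w_n / g_n) o t_n and rho o t_n
   is the integral of |w_n / g_n - rho| g_n <= |w_n - rho g_n|, which is small as
   soon as rho is a quotient of continuous approximations of w and g
   ([approx_rate]).  As rho o t_n tends to rho o t uniformly and the lengths L_n
   tend to L, the rates are close in L^1 ([rate_close]).

   Weak derivatives are tied to integrals by two facts: a primitive of an
   integrable function has this function as weak derivative
   ([weak_of_primitive], an application of Fubini), and a continuous function is
   a primitive of its weak derivative ([primitive_of_weak], the lemma of du
   Bois-Reymond).  The second one requires test functions; they are differences
   of translates of a smooth step built from exp (- 1 / x). *)

(** * Smooth steps *)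

Section smooth.
Context {R : realType}.
Implicit Types (f g : R -> R) (k n : nat).

(** k-fold differentiability, defined by recursion on the derivative so that the
   closure properties below are short inductions on k. *)
Fixpoint Ck k f : Prop :=
  if k is k'.+1 then (forall x, derivable f x 1) /\ Ck k' (f^`())%classic else True.

Lemma CkS k f : Ck k.+1 f -> Ck k f.
Proof. by elim: k f => // k IH f [df Cf]; split => //; exact: IH. Qed.

Lemma Ck_derive1n f : (forall k, Ck k f) ->
  forall n x, derivable (derive1n n f) x 1.
Proof.
move=> Cf n x; suff H : forall k, Ck k (derive1n n f) by have [] := H 1%N.
by elim: n => // n IH k; have [_] := IH k.+1; rewrite derive1nS.
Qed.

(** Lets smoothness proofs work with any explicit formula for the derivative. *)
Lemma Ck_ext_derive k f f' : (forall x : R, is_derive x (1:R) f (f' x)) ->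
  Ck k f' -> Ck k.+1 f.
Proof.
move=> H C'; split=> [x|]; first by have [] := H x.
by rewrite (_ : (f^`())%classic = f')//; apply/funext => x; rewrite derive1E; have [] := H x.
Qed.

Lemma Ck_derive k f : Ck k.+1 f -> forall x : R, is_derive x (1:R) f (f^`()%classic x).
Proof. by case=> df _ x; apply: DeriveDef => //; rewrite derive1E. Qed.

Lemma Ck_cst k (c : R) : Ck k (cst c).
Proof.
elim: k c => // k IH c; apply: (@Ck_ext_derive _ _ (cst 0)); last exact: IH.
Qed.

Lemma CkD k f g : Ck k f -> Ck k g -> Ck k (fun x => f x + g x).
Proof.
elim: k f g => // k IH f g Cf Cg.
apply: (@Ck_ext_derive _ _ (fun x => (f^`()%classic x) + (g^`()%classic x))).
  move=> x; have := Ck_derive Cf x; have := Ck_derive Cg x => ? ?.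
  exact: is_deriveD.
by apply: IH; [case: Cf|case: Cg].
Qed.

Lemma CkM k f g : Ck k f -> Ck k g -> Ck k (fun x => f x * g x).
Proof.
elim: k f g => // k IH f g Cf Cg.
apply: (@Ck_ext_derive _ _ (fun x => f x * (g^`()%classic x) + g x * (f^`()%classic x))).
  move=> x; have := Ck_derive Cf x; have := Ck_derive Cg x => ? ?.
  exact: is_deriveM.
by apply: CkD; apply: IH; try exact: CkS; [case: Cg|case: Cf].
Qed.

Lemma CkV k f : (forall x, f x != 0) -> Ck k f -> Ck k (fun x => (f x)^-1).
Proof.
move=> f0; elim: k => // k IH Cf.
apply: (@Ck_ext_derive _ _ (fun x => - 1 * ((f x)^-1 * (f x)^-1) * (f^`()%classic x))).
  move=> x; have := Ck_derive Cf x => ?.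
  apply: (is_derive_eq (is_deriveV (f0 x) _)).
  by rewrite /GRing.scale/= mulN1r expr2 invfM.
have CV := IH (CkS Cf).
apply: CkM; last by case: Cf.
by apply: CkM; [exact: Ck_cst|exact: CkM].
Qed.

Lemma Ck_affine k f (m c : R) : Ck k f -> Ck k (fun x => f (m * x + c)).
Proof.
elim: k f => // k IH f Cf.
apply: (@Ck_ext_derive _ _ (fun x => m * f^`()%classic (m * x + c))).
  move=> x; have := Ck_derive Cf (m * x + c) => df.
  have H : is_derive x 1 (fun x => m * x + c) m.
    by apply: is_derive_eq; rewrite addr0 /GRing.scale/= mulr1.
  have := @is_derive1_comp _ f (fun y => m * y + c) _ _ _ df H.
  by rewrite mulrC.
by apply: CkM; [exact: Ck_cst|apply: IH; case: Cf].
Qed.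

(** The functions p(1/x) exp(-1/x), extended by 0, form a family closed under
   derivation; smoothness of all of them is then proved by one induction. *)
Definition flat (p : {poly R}) (x : R) : R :=
  if 0 < x then p.[x^-1] * expR (- x^-1) else 0.

(** Each monomial satisfies y^n exp(-y) <= n!, by the exponential series. *)
Lemma poly_expRN_bounded (p : {poly R}) :
  exists C : R, forall y, 0 <= y -> `|p.[y] * expR (- y)| <= C.
Proof.
exists (\sum_(i < size p) `|p`_i| * i`!%:R) => y y0.
have powe i : y ^+ i * expR (- y) <= i`!%:R.
  rewrite expRN ler_pdivrMr ?expR_gt0//; case: i => [|i].
    by rewrite expr0 fact0 mul1r -expR0 ler_expR.
  have := expR_ge1Dxn i y0; set f := (i.+1)`!%:R => H.
  have f0 : 0 < f by rewrite ltr0n fact_gt0.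
  rewrite -ler_pdivrMl// mulrC; apply: le_trans H.
  by rewrite lerDr.
rewrite horner_coef mulr_suml; apply: le_trans (ler_norm_sum _ _ _) _.
apply: ler_sum => i _; rewrite -mulrA normrM ler_wpM2l//.
by rewrite ger0_norm ?powe// mulr_ge0 ?exprn_ge0// expR_ge0.
Qed.

(** At 0 the difference quotient p(1/h) exp(-1/h) / h equals
   h times (X^2 p)(1/h) exp(-1/h), and the second factor is bounded. *)
Lemma is_derive_flat (p : {poly R}) (x : R) :
  is_derive x (1:R) (flat p) (flat ('X^2 * (p - p^`())) x).
Proof.
have [x0|x0|<-] := ltgtP 0 x.
- have xN0 : x != 0 by rewrite gt_eqF.
  have iV : is_derive x (1:R) (fun y : R => y^-1) (- x ^- 2).
    by apply: (is_derive_eq (is_deriveV xN0 (is_derive_id _ _))); rewrite /GRing.scale/= mulr1.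
  have iN : is_derive x (1:R) (fun y : R => - y^-1) (x ^- 2).
    by apply: is_derive_eq; rewrite opprK.
  have i1 := @is_derive1_comp _ (horner p) _ _ _ _ (is_derive_poly p x^-1) iV.
  have i2 := @is_derive1_comp _ expR (fun y => - y^-1) _ _ _ (is_derive_expR (- x^-1)) iN.
  have i3 := is_deriveM i1 i2.
  apply: (@near_eq_is_derive _ _ _ ((horner p \o GRing.inv) * (expR \o (fun y : R => - y^-1)))).
  + near=> y; rewrite /flat ifT//; near: y; exact: lt_nbhsr.
  + apply: is_derive_eq; rewrite /flat x0 /GRing.scale/=.
    rewrite hornerM hornerXn hornerD hornerN exprVn; ring.
- apply: (@near_eq_is_derive _ _ _ (cst 0)).
  + near=> y; rewrite /flat ifF//; apply/negbTE; rewrite -leNgt ltW//.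
    by near: y; exact: lt_nbhsl.
  + by rewrite /flat ltNge (ltW x0)/=; exact: is_derive_cst.
- have [C HC] := poly_expRN_bounded ('X^2 * p).
  have C0 : 0 <= C by apply: le_trans (HC 0 (lexx _)).
  have cv : h^-1 *: (flat p (h *: 1 + 0) - flat p 0) @[h --> (0:R)^'] --> (0:R).
    apply/cvgrPdist_le => e e0; near=> h.
    rewrite sub0r normrN /flat ltxx subr0 addr0 /GRing.scale/= mulr1.
    case: ifPn => h0; last by rewrite mulr0 normr0 ltW.
    have hN0 : h != 0 by rewrite gt_eqF.
    have -> : h^-1 * (p.[h^-1] * expR (- h^-1)) =
              h * (('X^2 * p).[h^-1] * expR (- h^-1)).
      by rewrite hornerM hornerXn; field.
    rewrite normrM (gtr0_norm h0); apply: (@le_trans _ _ (h * (C + 1))).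
      by rewrite ler_pM2l// (le_trans (HC _ _)) ?lerDl// invr_ge0 ltW.
    rewrite -ler_pdivlMr; last lra.
    apply: le_trans (ler_norm _) _.
    near: h; apply: dnbhs0_le; rewrite divr_gt0//; lra.
  have fl0 q : flat q 0 = 0 by rewrite /flat ltxx.
  rewrite fl0; apply: DeriveDef.
    by apply/cvg_ex; exists 0.
  by apply/cvg_lim; first exact: Rhausdorff.
Unshelve. all: by end_near. Qed.

Lemma Ck_flat k p : Ck k (flat p).
Proof.
elim: k p => // k IH p.
by apply: (Ck_ext_derive (is_derive_flat p)); exact: IH.
Qed.

Lemma flat_le0 p x : x <= 0 -> flat p x = 0.
Proof. by move=> x0; rewrite /flat ltNge x0. Qed.

Lemma flat1_gt0 x : 0 < x -> 0 < flat 1 x.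
Proof. by move=> x0; rewrite /flat x0 hornerC mul1r expR_gt0. Qed.

Lemma flat1_ge0 x : 0 <= flat 1 x.
Proof. by rewrite /flat; case: ifP => // _; rewrite hornerC mul1r expR_ge0. Qed.

(** A smooth passage from 0, left of 0, to 1, right of 1. *)
Definition step (z : R) : R := flat 1 z * (flat 1 z + flat 1 (-1 * z + 1))^-1.

Let step_den z : 0 < flat 1 z + flat 1 (-1 * z + 1).
Proof.
have [z0|z0] := ltP 0 z; first by rewrite ltr_pwDl ?flat1_gt0 ?flat1_ge0.
by rewrite ltr_wpDl ?flat1_ge0 ?flat1_gt0//; lra.
Qed.

Lemma Ck_step k : Ck k step.
Proof.
apply: CkM; first exact: Ck_flat.
apply: CkV => [x|]; first by rewrite gt_eqF.
by apply: CkD; [exact: Ck_flat|apply: Ck_affine; exact: Ck_flat].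
Qed.

Lemma step_le0 z : z <= 0 -> step z = 0.
Proof. by move=> z0; rewrite /step flat_le0// mul0r. Qed.

Lemma step_ge1 z : 1 <= z -> step z = 1.
Proof.
move=> z1; rewrite /step [flat 1 (-1 * z + 1)]flat_le0; last lra.
by rewrite addr0 divff// gt_eqF// flat1_gt0//; lra.
Qed.

(** Monotonicity makes the derivative of a step a positive averaging kernel. *)
Lemma step'_ge0 z : 0 <= step^`()%classic z.
Proof.
pose d := flat ('X^2 * (1 - (1 : {poly R})^`())).
have d0 x : 0 <= d x.
  rewrite /d /flat derivC subr0 mulr1 hornerXn; case: ifP => // _.
  by rewrite mulr_ge0 ?sqr_ge0 ?expR_ge0.
have f1 := is_derive_flat 1 z.
have g1 : is_derive z (1:R) (fun x : R => -1 * x + 1) (-1).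
  by apply: is_derive_eq; rewrite addr0 /GRing.scale/= mulr1.
have f2 := @is_derive1_comp _ (flat 1) (fun y => -1 * y + 1) _ _ _
  (is_derive_flat 1 (-1 * z + 1)) g1.
have f3 := @is_deriveV _ (fun z => flat 1 z + flat 1 (-1 * z + 1)) _ _ _ (lt0r_neq0 (step_den z)) (is_deriveD f1 f2).
have f4 := is_deriveM f1 f3.
rewrite derive1E (@derive_val _ _ _ _ _ _ _ f4) /GRing.scale/=.
rewrite -/(d z) -/(d (-1 * z + 1)).
set F := flat 1 z; set H := flat 1 (-1 * z + 1).
have D0 : 0 < F + H := step_den z.
rewrite [leRHS](_ : _ = (d z * H + F * d (-1 * z + 1)) * (F + H) ^- 2).
  by rewrite mulr_ge0 ?invr_ge0 ?sqr_ge0// addr_ge0// mulr_ge0// flat1_ge0.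
field; exact: lt0r_neq0.
Qed.

End smooth.

(** * Primitives are weakly differentiable *)

Section weak.
Context {R : realType}.
Notation mu := (@lebesgue_measure R).
Implicit Types (c d x y r : R) (u v phi : R -> R).

Lemma FTC2_oo phi phi' x y : (forall z : R, is_derive z (1:R) phi (phi' z)) ->
  continuous phi' -> x <= y ->
  \int[mu]_(z in `]x, y[) phi' z = phi y - phi x.
Proof.
move=> dphi cphi'; rewrite le_eqVlt => /predU1P[->|xy].
  by rewrite set_itvoo0 Rintegral_set0 subrr.
have cphi : continuous phi.
  by move=> z; apply/differentiable_continuous/derivable1_diffP; case: (dphi z).
rewrite /Rintegral -(@integral_itv_bndoo R x y (EFin \o phi') true false); last first.
  apply/measurable_EFinP; apply: measurable_funTS.
  exact: continuous_measurable_fun.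
rewrite (@continuous_FTC2 R phi' phi)//=.
- exact: continuous_subspaceT.
- split; first by move=> z _; case: (dphi z).
  + by apply: cvg_at_right_filter; exact: cphi.
  + by apply: cvg_at_left_filter; exact: cphi.
- by move=> z _; rewrite derive1E; case: (dphi z).
Qed.

Lemma test_is_derive (J : set R) phi : test_function J phi ->
  forall z : R, is_derive z (1:R) phi (phi^`()%classic z).
Proof.
by move=> [d _ _] z; apply: DeriveDef; [exact: (d 0%N)|rewrite derive1E].
Qed.

Lemma test_continuous' (J : set R) phi : test_function J phi ->
  continuous (phi^`()%classic).
Proof.
move=> [d _ _] z; apply/differentiable_continuous/derivable1_diffP.
exact: (d 1%N).
Qed.

Lemma test_continuous (J : set R) phi : test_function J phi -> continuous phi.
Proof.
move=> /test_is_derive d z; apply/differentiable_continuous/derivable1_diffP.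
by case: (d z).
Qed.

Lemma test_out (J : set R) phi z : test_function J phi -> ~ J z -> phi z = 0.
Proof.
move=> [_ _ s] Jz; apply/eqP; apply: contra_notT Jz => p.
by apply: s; apply: subset_closure.
Qed.

(** One component of [is_weak_deriv J u v], which unfolds to this property of
   all components of u and v. *)
Definition weak_derivative (J : set R) u v :=
  locally_integrable J v /\
    forall phi, test_function J phi ->
      \int[mu]_(x in J) (u x * derive1 phi x) =
      - \int[mu]_(x in J) (v x * phi x).

Lemma integrable_bounded_mul (D : set R) u v (M : R) : measurable D ->
  measurable_fun D u -> (forall x, D x -> `|u x| <= M) ->
  mu.-integrable D (EFin \o v) ->
  mu.-integrable D (EFin \o (fun x => u x * v x)).
Proof.
move=> mD mfu uM iv.
have mv : measurable_fun D v by apply/measurable_EFinP; case/integrableP: iv.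
have iv2 : mu.-integrable D (fun x => (`|M|%:E * (EFin \o v) x)%E).
  exact: integrableZl.
apply: le_integrable iv2 => //= [|x Dx].
  by apply/measurable_EFinP; exact: measurable_funM.
rewrite lee_fin !normrM normr_id ler_wpM2r//.
by rewrite (le_trans (uM _ Dx))// ler_norm.
Qed.

Lemma EFin_Rintegral (D : set R) u : mu.-integrable D (EFin \o u) ->
  measurable D -> (\int[mu]_(x in D) u x)%:E = (\int[mu]_(x in D) (u x)%:E)%E.
Proof. by move=> iu mD; rewrite fineK//; exact: integrable_fin_num. Qed.

Lemma Rintegral_oo_split x y z u : x <= y -> y <= z ->
  mu.-integrable `]x, z[ (EFin \o u) ->
  \int[mu]_(t in `]x, z[) u t = \int[mu]_(t in `]x, y[) u t + \int[mu]_(t in `]y, z[) u t.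
Proof.
move=> xy; rewrite le_eqVlt => /predU1P[->|yz] iu.
  by rewrite set_itvoo0 Rintegral_set0 addr0.
rewrite [X in X + _]Rintegral_itv_bndo_bndc; last first.
  by apply: integrableS iu => //; apply: subset_itvl; rewrite bnd_simp ltW.
by rewrite -(@Rintegral_itvB R u (BRight x) (BLeft z) y)// ?bnd_simp// addrC subrK.
Qed.

Lemma continuous_bounded_itv u c d : {within `[c, d], continuous u} ->
  exists M, forall x, x \in `[c, d] -> `|u x| <= M.
Proof.
move=> cu.
have [M [_ HM]] := compact_bounded (continuous_compact cu (@segment_compact _ c d)).
exists (M + 1) => x xcd; apply: HM; first by rewrite ltrDl.
by exists x.
Qed.

Lemma mem_oo c d x : (x \in `]c, d[%classic) = (c < x < d).
Proof. by apply/idP/idP; rewrite inE/= in_itv. Qed.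

(** With U a primitive of v, integrating v(x) phi'(y) over the triangle
   c < x < y < d gives the integral of U phi' when x is integrated first, and that
   of - v phi when y is integrated first, because phi vanishes at d.  The constant
   by which u differs from U is harmless, because the integral of phi' is 0. *)
Lemma weak_of_primitive c d u v : c < d ->
  mu.-integrable `]c, d[ (EFin \o v) ->
  (forall x y, c < y -> y <= x -> x < d -> u x - u y = \int[mu]_(z in `]y, x[) v z) ->
  weak_derivative `]c, d[ u v.
Proof.
move=> cd iv uv; split; first by apply: open_integrable_locally => //; exact: interval_open.
move=> phi tphi.
have dphi := test_is_derive tphi; have cphi' := test_continuous' tphi.
have cphi := test_continuous tphi.
have phic : phi c = 0 by apply: (test_out tphi); rewrite /= in_itv/= ltxx.
have phid : phi d = 0 by apply: (test_out tphi); rewrite /= in_itv/= ltxx andbF.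
have [M phiM] : exists M, forall x, x \in `[c, d] -> `|phi^`()%classic x| <= M.
  by apply: continuous_bounded_itv; exact: continuous_subspaceT.
have M0 : 0 <= M.
  by apply: le_trans (phiM c _) => //; rewrite in_itv/= lexx ltW.
set J := `]c, d[%classic; pose phi' := phi^`()%classic.
have mJ : measurable J by exact: measurable_itv.
have mphi' : measurable_fun [set: R] phi' by exact: continuous_measurable_fun.
pose vJ := v \_ J; pose pJ := phi' \_ J.
have mv : measurable_fun J v by apply/measurable_EFinP; case/integrableP: iv.
have mvJ : measurable_fun [set: R] vJ by exact/(measurable_restrictT _ _).1.
have mpJ : measurable_fun [set: R] pJ.
  by apply/(measurable_restrictT _ _).1 => //; exact: measurable_funTS.
have pJM x : `|pJ x| <= M * \1_J x.
  rewrite /pJ patchE indicE; case: ifPn => [|_]; last by rewrite mulr0 normr0.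
  rewrite inE /J/= => xJ; rewrite mulr1 phiM//; exact: subset_itv_oo_cc.
pose lt1 (x y : R) : R := if x < y then 1 else 0.
have mlt1 : measurable_fun [set: R * R] (fun z => lt1 z.2 z.1).
  by apply: measurable_fun_ifT => //; exact: measurable_fun_ltr.
(* The integrand v(x) phi'(y), cut to the triangle, at z = (y, x). *)
pose f (z : R * R) := (vJ z.2 * pJ z.1 * lt1 z.2 z.1)%:E.
have mf : measurable_fun [set: R * R] f.
  apply/measurable_EFinP; apply: measurable_funM => //.
  by apply: measurable_funM; [exact: measurableT_comp|exact: measurableT_comp].
have mfx x : measurable_fun [set: R] (fun y => vJ x * pJ y * lt1 x y).
  apply/measurable_EFinP; change (measurable_fun [set: R] (fun y => f (y, x))).
  by apply: (@measurableT_comp _ _ _ _ _ _ f _ (fun y => (y, x))) => //; exact: pair2_measurable.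
have ivJ : mu.-integrable [set: R] (EFin \o vJ).
  rewrite /vJ -restrict_EFin; apply/integrable_restrict => //.
  by rewrite setTI.
have fint : (mu \x mu)%E.-integrable [set: R * R] f.
  apply/(@integrable21ltyP _ _ (measurableTypeR R) (measurableTypeR R) R mu mu f mf) => /=.
  apply: (@le_lt_trans _ _ (\int[mu]_x (`|vJ x|%:E * (M * (d - c))%:E))%E).
    apply: ge0_le_integral => //=.
    - by move=> x _; exact: integral_ge0.
    - apply: (@measurable_fun_fubini_tonelli_G _ _ _ _ _ mu (abse \o f)) => //=.
      exact: measurableT_comp.
    - apply/measurable_EFinP; apply: measurable_funM => //.
      exact: measurableT_comp.
    - move=> x _; apply: (@le_trans _ _ (\int[mu]_y (`|vJ x| * M * \1_J y)%:E)%E).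
        apply: ge0_le_integral => //=.
        + apply/measurable_EFinP; apply: measurableT_comp => //.
          exact: mfx.
        + by apply/measurable_EFinP; exact: measurable_funM.
        + move=> y _; rewrite lee_fin !normrM -mulrA -mulrA ler_wpM2l//.
          apply: le_trans (pJM y).
          by rewrite -[leRHS]mulr1 ler_wpM2l// /lt1; case: (_ < _); rewrite ?normr1 ?normr0.
      under eq_integral do rewrite EFinM.
      rewrite integralZl//; last exact: integrable_indic_itv.
      rewrite integral_indic//= setIT /J lebesgue_measure_itv/= lte_fin cd.
      by rewrite -EFinD -!EFinM mulrA.
  rewrite ge0_integralZr ?lee_fin ?mulr_ge0 ?subr_ge0 ?(ltW cd)//; last first.
    by apply/measurable_EFinP; exact: measurableT_comp.
  rewrite muleC; apply: lte_mul_pinfty => //.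
    by rewrite lee_fin mulr_ge0// subr_ge0 ltW.
  by case/integrableP: ivJ.
pose U y := \int[mu]_(z in `]c, y[) v z.
have ivS x y : c <= x -> y <= d -> mu.-integrable `]x, y[ (EFin \o v).
  by move=> cx yd; apply: integrableS iv => //; apply: subset_itv; rewrite bnd_simp.
have inner1 y : (\int[mu]_x f (y, x) = (((fun y => U y * phi' y) \_ J) y)%:E)%E.
  have [yJ|yJ] := boolP (y \in J); last first.
    rewrite patchE (negbTE yJ); apply: integral0_eq => x _.
    by rewrite /f/= /lt1 /pJ patchE (negbTE yJ) mulr0 mul0r.
  have := yJ; rewrite inE /J/= in_itv/= => /andP[cy yd].
  have iy : mu.-integrable `]c, y[ (EFin \o v) by apply: ivS => //; exact: ltW.
  rewrite patchE yJ /U -RintegralZr//.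
  rewrite EFin_Rintegral//; last first.
    by rewrite (_ : _ \o _ = fun x => ((EFin \o v) x * (phi' y)%:E)%E)//; exact: integrableZr.
  rewrite [RHS]integral_mkcond; apply: eq_integral => x _.
  rewrite /f/= /lt1 /pJ patchE yJ /vJ !patchE.
  rewrite !mem_oo; have [cx|] := ltP c x; last by rewrite !mul0r.
  have [xy|] := ltP x y; last by rewrite mulr0.
  by rewrite (lt_trans xy yd) mulr1.
have ipcc : mu.-integrable `[c, d] (EFin \o phi').
  by apply: continuous_compact_integrable; [exact: segment_compact|exact: continuous_subspaceT].
have inner2 x : (\int[mu]_y f (y, x) = (((fun x => - (v x * phi x)) \_ J) x)%:E)%E.
  have [xJ|xJ] := boolP (x \in J); last first.
    rewrite patchE (negbTE xJ); apply: integral0_eq => y _.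
    by rewrite /f/= /lt1 /vJ patchE (negbTE xJ) !mul0r.
  have := xJ; rewrite inE /J/= in_itv/= => /andP[cx xd].
  rewrite patchE xJ.
  have -> : - (v x * phi x) = v x * \int[mu]_(y in `]x, d[) phi' y.
    by rewrite (FTC2_oo dphi)// ?(ltW xd)// phid sub0r mulrN.
  have ip : mu.-integrable `]x, d[ (EFin \o phi').
    by apply: integrableS ipcc => //; apply: subset_itv; rewrite bnd_simp// ltW.
  rewrite -RintegralZl// EFin_Rintegral//; last first.
    by rewrite (_ : _ \o _ = fun y => ((v x)%:E * (EFin \o phi') y)%E)//; exact: integrableZl.
  rewrite [RHS]integral_mkcond; apply: eq_integral => y _.
  rewrite /f/= /lt1 /vJ patchE xJ /pJ !patchE.
  rewrite !mem_oo; have [yd|] := ltP y d; last by rewrite !andbF mulr0 mul0r.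
  have [xy|] := ltP x y; last by rewrite mulr0.
  by rewrite (lt_trans cx xy) mulr1.
have iU : mu.-integrable J (EFin \o (fun y => U y * phi' y)).
  rewrite -[J]setTI; apply/integrable_restrict => //.
  have := integrable_fubini_F fint; apply: eq_integrable => // y _.
  by rewrite /fubini_F inner1 /= restrict_EFin.
pose x0 := (c + d) / 2; pose k := u x0 - U x0.
have uU y : y \in J -> u y = k + U y.
  rewrite inE /J/= in_itv/= => /andP[cy yd]; rewrite /k.
  have [yx|xy] := leP y x0.
    have := uv x0 y cy yx; rewrite /x0 => H.
    have {}H := H ltac:(lra).
    have := @Rintegral_oo_split c y x0 v (ltW cy) yx (ivS _ _ _ _); rewrite -/(U _) -/(U _).
    by rewrite lexx /x0 => H2; rewrite H2//; lra.
  have := uv y x0; rewrite /x0 => H.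
  have {}H := H ltac:(lra) (ltW xy) yd.
  have := @Rintegral_oo_split c x0 y v _ (ltW xy) (ivS _ _ _ _); rewrite -/(U _) -/(U _).
  by rewrite lexx /x0 => H2; rewrite H2//; lra.
have iphi' : mu.-integrable J (EFin \o phi').
  by apply: integrableS ipcc => //; exact: subset_itv_oo_cc.
have ivphi : mu.-integrable J (EFin \o (fun x => v x * phi x)).
  have [M' HM'] : exists M, forall x, x \in `[c, d] -> `|phi x| <= M.
    by apply: continuous_bounded_itv; exact: continuous_subspaceT.
  rewrite (_ : (fun x => _) = fun x => phi x * v x); last by apply/funext => x; rewrite mulrC.
  apply: (integrable_bounded_mul (M := M')) => //.
    by apply: measurable_funTS; exact: continuous_measurable_fun.
  by move=> x xJ; apply: HM'; exact: subset_itv_oo_cc.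
transitivity (\int[mu]_(x in J) (k * phi' x + U x * phi' x)).
  by apply: eq_Rintegral => y yJ; rewrite uU// mulrDl.
rewrite RintegralD//; last first.
  by rewrite (_ : _ \o _ = fun y => (k%:E * (EFin \o phi') y)%E)//; exact: integrableZl.
rewrite RintegralZl// (FTC2_oo dphi)// ?(ltW cd)// phic phid subrr mulr0 add0r.
apply: EFin_inj; rewrite EFinN !EFin_Rintegral//.
rewrite -integralN; last exact: integrable_add_def.
rewrite [LHS]integral_mkcond [RHS]integral_mkcond.
transitivity (\int[mu]_y \int[mu]_x f (y, x))%E.
  by apply: eq_integral => y _; rewrite inner1 !patchE; case: ifP.
rewrite (Fubini fint); apply: eq_integral => x _; rewrite inner2.
by rewrite !patchE; case: ifP.
Qed.
End weak.

(** * Test functions built from steps *)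

Section weak2.
Context {R : realType}.
Notation mu := (@lebesgue_measure R).
Implicit Types (c d x y r : R) (u v phi h : R -> R).

Lemma Rintegral_supp (J K : set R) h : K `<=` J ->
  (forall z, J z -> ~ K z -> h z = 0) ->
  \int[mu]_(z in J) h z = \int[mu]_(z in K) h z.
Proof.
move=> KJ h0; rewrite Rintegral_mkcond [RHS]Rintegral_mkcond; congr Rintegral.
apply/funext => z; rewrite !patchE.
have [Jz|Jz] := pselect (J z); have [Kz|Kz] := pselect (K z).
- by rewrite !mem_set.
- by rewrite mem_set// memNset// h0.
- by have := Jz (KJ _ Kz).
- by rewrite !memNset.
Qed.

Lemma integrable_supp (J K : set R) h : measurable J -> measurable K -> K `<=` J ->
  (forall z, J z -> ~ K z -> h z = 0) ->
  mu.-integrable K (EFin \o h) -> mu.-integrable J (EFin \o h).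
Proof.
move=> mJ mK KJ h0 iK.
have : mu.-integrable J ((EFin \o h) \_ K).
  by apply/integrable_restrict => //; rewrite setIidr.
apply: eq_integrable => // z; rewrite inE patchE => Jz.
by case: ifPn => [//|/negP]; rewrite inE => Kz /=; rewrite h0.
Qed.

Lemma derive0_out (J : set R) phi z : test_function J phi ->
  ~ J z -> phi^`()%classic z = 0.
Proof.
move=> [_ _ s] Jz; rewrite derive1E.
have oC : open (~` closure [set x | phi x != 0]).
  by apply: closed_openC; exact: closed_closure.
have H : nbhs z (~` closure [set x | phi x != 0]).
  by apply: open_nbhs_nbhs; split => // /s.
rewrite (@near_eq_derive _ _ _ _ (cst 0) z 1) ?derive_cst//.
near=> t; have : (~` closure [set x | phi x != 0]) t by near: t.
by move=> ct /=; apply/eqP; apply: contra_notT ct => pt; exact: subset_closure.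
Unshelve. all: by end_near. Qed.

Lemma test_functionS (J J' : set R) phi : J `<=` J' ->
  test_function J phi -> test_function J' phi.
Proof. by move=> JJ' [? ? s]; split => //; exact: subset_trans JJ'. Qed.

Lemma locally_integrableS_oo c d c' d' v : c < c' -> d' < d ->
  locally_integrable `]c, d[ v -> mu.-integrable `]c', d'[ (EFin \o v).
Proof.
move=> cc dd [mv _ H]; have sub : `[c', d'] `<=` `]c, d[.
  by apply: subset_itv; rewrite bnd_simp.
have sub2 : `]c', d'[ `<=` `]c, d[ by apply: subset_trans sub; exact: subset_itv_oo_cc.
have : mu.-integrable `[c', d'] (EFin \o v).
  apply/integrableP; split.
    by apply/measurable_EFinP; apply: measurable_funS mv.
  exact: H sub (@segment_compact _ _ _).
by apply: integrableS => //; exact: subset_itv_oo_cc.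
Qed.

(** Strict inequalities put [c', d'] inside ]c, d[, so that v becomes integrable
   on ]c', d'[ and not merely locally so. *)
Lemma weak_derivativeS c d c' d' u v : c < c' -> d' < d ->
  weak_derivative `]c, d[ u v -> weak_derivative `]c', d'[ u v.
Proof.
move=> cc dd [lv H].
have sub : `]c', d'[ `<=` `]c, d[.
  by apply: subset_itv; rewrite bnd_simp ltW.
split.
  apply: open_integrable_locally; first exact: interval_open.
  exact: locally_integrableS_oo lv.
move=> phi tphi; have := H _ (test_functionS sub tphi).
rewrite (@Rintegral_supp _ `]c', d'[)//; last first.
  by move=> z _ zJ; rewrite (derive0_out tphi)// mulr0.
rewrite [in X in _ = - X -> _](@Rintegral_supp _ `]c', d'[)//.
by move=> z _ zJ; rewrite (test_out tphi)// mulr0.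
Qed.

(** Rises from 0 at x to 1 at x + r; its derivative is a probability density on
   [x, x + r]. *)
Definition shift_step x r (z : R) := step (r^-1 * z + - (r^-1 * x)).

Lemma Ck_shift_step k x r : Ck k (shift_step x r).
Proof. by apply: Ck_affine; exact: Ck_step. Qed.

Lemma shift_step_le x r z : 0 < r -> z <= x -> shift_step x r z = 0.
Proof.
by move=> r0 zx; rewrite /shift_step step_le0// subr_le0 ler_pM2l ?invr_gt0.
Qed.

Lemma shift_step_ge x r z : 0 < r -> x + r <= z -> shift_step x r z = 1.
Proof.
move=> r0 zx; rewrite /shift_step step_ge1// -mulrBr mulrC ler_pdivlMr//.
by rewrite mul1r; lra.
Qed.

Lemma is_derive_shift_step x r z :
  is_derive z (1:R) (shift_step x r) ((shift_step x r)^`()%classic z).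
Proof. by apply: (@Ck_derive _ 0); exact: Ck_shift_step. Qed.

Lemma cont_shift_step' x r : continuous ((shift_step x r)^`()%classic).
Proof.
move=> z; have [_ C1] := @Ck_shift_step 2 x r.
by apply/differentiable_continuous/derivable1_diffP; case: C1.
Qed.

Lemma shift_step'_ge0 x r z : 0 < r -> 0 <= (shift_step x r)^`()%classic z.
Proof.
move=> r0.
have g1 : is_derive z (1:R) (fun z : R => r^-1 * z + - (r^-1 * x)) r^-1.
  have H := is_deriveD (is_deriveM (is_derive_cst r^-1 z 1) (is_derive_id z 1))
                       (is_derive_cst (- (r^-1 * x)) z 1).
  by apply: (is_derive_eq H); rewrite /GRing.scale/= mulr0 !addr0 mulr1.
have f2 := @is_derive1_comp _ step (fun z => r^-1 * z + - (r^-1 * x)) _ _ _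
  (@Ck_derive _ 0 step (@Ck_step R 1) _) g1.
rewrite derive1E (@derive_val _ _ _ _ _ _ _ f2).
by rewrite mulr_ge0 ?step'_ge0// invr_ge0 ltW.
Qed.

Lemma shift_step'_out x r z : 0 < r -> ~ (x <= z <= x + r) ->
  (shift_step x r)^`()%classic z = 0.
Proof.
move=> r0 /negP; rewrite negb_and -!ltNge derive1E => /orP[zx|xz].
  rewrite (@near_eq_derive _ _ _ _ (cst 0) z 1) ?derive_cst//.
  by near=> t; rewrite shift_step_le// ltW//; near: t; exact: lt_nbhsl.
rewrite (@near_eq_derive _ _ _ _ (cst (1:R)) z 1) ?derive_cst//.
by near=> t; rewrite shift_step_ge// ltW//; near: t; exact: lt_nbhsr.
Unshelve. all: by end_near. Qed.

(** The two steps cancel on both sides of the points x, y, x + r, y + r, which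
   leaves a compact support. *)
Lemma test_step_diff c d x y r : 0 < r -> c < x -> x + r < d -> c < y -> y + r < d ->
  test_function `]c, d[ (fun z => shift_step x r z + -1 * shift_step y r z).
Proof.
move=> r0 cx xd cy yd.
pose m := Num.min x y; pose M := Num.max x y + r.
have sub : closure [set z | shift_step x r z + -1 * shift_step y r z != 0] `<=` `[m, M].
  have cl : closed `[m, M]%classic by exact: interval_closed.
  rewrite closureE; apply: smallest_sub => // z /= H.
  rewrite in_itv/= /m /M; apply/andP; split; rewrite leNgt; apply: contra_neqN H.
    by rewrite lt_min => /andP[zx zy]; rewrite !shift_step_le ?ltW// mulr0 addr0.
  by rewrite -ltrBrDr gt_max !ltrBrDr => /andP[zx zy]; rewrite !shift_step_ge ?ltW//; lra.
split.
- apply: Ck_derive1n => k; apply: CkD; first exact: Ck_shift_step.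
  by apply: CkM; [exact: Ck_cst|exact: Ck_shift_step].
- apply: (subclosed_compact _ (@segment_compact _ m M)) => //.
  exact: closed_closure.
- apply: (subset_trans sub) => z /=; rewrite !in_itv/= /m /M => /andP[mz zM].
  have : c < Num.min x y by rewrite lt_min cx.
  have : Num.max x y < d - r by rewrite gt_max; apply/andP; split; lra.
  by move=> ? ?; apply/andP; split; lra.
Qed.

Lemma Rintegral_oo_cc x y h : mu.-integrable `]x, y[ (EFin \o h) ->
  \int[mu]_(z in `]x, y[) h z = \int[mu]_(z in `[x, y]) h z.
Proof.
move=> ih; rewrite /Rintegral (@integral_itv_bndoo R x y (EFin \o h) true false)//.
by case/integrableP : ih.
Qed.

End weak2.

(** * The lemma of du Bois-Reymond *)

Section weak3.
Context {R : realType}.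
Notation mu := (@lebesgue_measure R).
Implicit Types (c d x y r : R) (u v phi h : R -> R).

Lemma integrable_step' x r (D : R -> R) : 0 < r -> {within `[x, x + r], continuous D} ->
  mu.-integrable `[x, x + r] (EFin \o (fun z => D z * (shift_step x r)^`()%classic z)).
Proof.
move=> r0 cD; apply: continuous_compact_integrable; first exact: segment_compact.
move=> z; apply: cvgM; first exact: cD.
by apply: continuous_subspaceT; exact: cont_shift_step'.
Qed.

Lemma Rintegral_step' x r : 0 < r ->
  \int[mu]_(z in `[x, x + r]) (shift_step x r)^`()%classic z = 1.
Proof.
move=> r0; rewrite -Rintegral_oo_cc; last first.
  have := @integrable_step' x r (cst 1) r0 (@continuous_subspaceT _ _ _ _ (@cst_continuous _ _ _)).
  rewrite (_ : (fun z => _) = (shift_step x r)^`()%classic).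
    by apply: integrableS => //; exact: subset_itv_oo_cc.
  by apply/funext => z; rewrite mul1r.
rewrite (FTC2_oo (is_derive_shift_step x r) (@cont_shift_step' R x r)) ?lerDl ?ltW//.
by rewrite shift_step_ge// shift_step_le// subr0.
Qed.

Lemma step_average x r (D : R -> R) (e : R) : 0 < r -> {within `[x, x + r], continuous D} ->
  (forall z, z \in `[x, x + r] -> `|D z - D x| <= e) ->
  `|\int[mu]_(z in `[x, x + r]) (D z * (shift_step x r)^`()%classic z) - D x| <= e.
Proof.
move=> r0 cD De; have iD := integrable_step' r0 cD.
have ic (k : R) := @integrable_step' x r (cst k) r0 (@continuous_subspaceT _ _ _ _ (@cst_continuous _ _ _)).
have i1 : mu.-integrable `[x, x + r] (EFin \o (shift_step x r)^`()%classic).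
  by apply: eq_integrable (ic 1) => // z _ /=; rewrite mul1r.
have Ik k : \int[mu]_(z in `[x, x + r]) (k * (shift_step x r)^`()%classic z) = k.
  by rewrite RintegralZl// Rintegral_step'// mulr1.
rewrite ler_norml; apply/andP; split.
  rewrite lerBrDr -[leLHS]Ik; apply: le_Rintegral => //; first exact: ic.
  move=> z zx; rewrite ler_wpM2r ?shift_step'_ge0//.
  by have := De z zx; rewrite ler_norml => /andP[+ _]; lra.
rewrite lerBlDr -[leRHS]Ik; apply: le_Rintegral => //; first exact: ic.
move=> z zx; rewrite ler_wpM2r ?shift_step'_ge0//.
by have := De z zx; rewrite ler_norml => /andP[_]; lra.
Qed.

(** Concluding arithmetic of the next lemma, with abstract reals in place of the
   integrals A, A', B and B'. *)
Lemma close_of_averages (A B A' B' p q e : R) : A = A' -> B = B' -> A - B = 0 ->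
  `|A' - p| <= e / 2 -> `|B' - q| <= e / 2 -> `|p - q| <= e.
Proof.
move=> -> -> AB; rewrite !ler_norml => /andP[? ?] /andP[? ?].
by apply/andP; split; lra.
Qed.

(** Testing against the difference of the steps at x and y shows that the averages
   of D over [x, x + r] and [y, y + r] agree; as r tends to 0 these averages tend
   to D x and D y. *)
Lemma constant_of_weak0 c d (D : R -> R) : {in `]c, d[, continuous D} ->
  (forall phi, test_function `]c, d[ phi ->
     \int[mu]_(z in `]c, d[) (D z * phi^`()%classic z) = 0) ->
  {in `]c, d[ &, forall x y, D x = D y}.
Proof.
move=> cD D0 x y xcd ycd; apply/eqP; rewrite -subr_eq0 -normr_le0.
apply/ler_addgt0Pr => e e0; rewrite add0r.
have e20 : 0 < e / 2 by rewrite divr_gt0.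
have loc t : t \in `]c, d[ -> \forall r \near 0^'+,
    t + r < d /\ (forall z, z \in `[t, t + r] -> `|D z - D t| <= e / 2).
  move=> tcd; have /cvgrPdist_le/(_ _ e20) := cD t tcd.
  move=> /nbhs_ballP[s /= s0 Hs].
  near=> r; split.
    rewrite -ltrBrDl; near: r; apply: nbhs_right_lt; rewrite subr_gt0.
    by move: tcd; rewrite in_itv/= => /andP[].
  move=> z; rewrite in_itv/= => /andP[tz zr]; rewrite distrC; apply: Hs.
  rewrite /ball/= ler0_norm ?subr_le0// opprB.
  rewrite ltrBlDr (le_lt_trans zr)// addrC ltrD2r.
  by near: r; exact: nbhs_right_lt.
have [r [r0 [xrd Dx] [yrd Dy]]] : exists r, [/\ 0 < r,
   x + r < d /\ (forall z, z \in `[x, x + r] -> `|D z - D x| <= e / 2) &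
   y + r < d /\ (forall z, z \in `[y, y + r] -> `|D z - D y| <= e / 2)].
  near ((0:R)^'+) => r; exists r; split => //.
  - by near: r; apply: loc.
  - by near: r; apply: loc.
move: (xcd) (ycd); rewrite !in_itv/= => /andP[cx xd] /andP[cy yd].
have := D0 _ (test_step_diff r0 cx xrd cy yrd).
have subx : `[x, x + r] `<=` `]c, d[ by apply: subset_itv; rewrite bnd_simp.
have suby : `[y, y + r] `<=` `]c, d[ by apply: subset_itv; rewrite bnd_simp.
have cDx : {within `[x, x + r], continuous D}.
  by apply: continuous_in_subspaceT => z; rewrite inE => /subx zc; apply: cD.
have cDy : {within `[y, y + r], continuous D}.
  by apply: continuous_in_subspaceT => z; rewrite inE => /suby zc; apply: cD.
have outx z : `]c, d[%classic z -> ~ `[x, x + r]%classic z ->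
    D z * (shift_step x r)^`()%classic z = 0.
  by move=> _; rewrite /= in_itv/= => Hz; rewrite shift_step'_out// mulr0.
have outy z : `]c, d[%classic z -> ~ `[y, y + r]%classic z ->
    D z * (shift_step y r)^`()%classic z = 0.
  by move=> _; rewrite /= in_itv/= => Hz; rewrite shift_step'_out// mulr0.
have ix := integrable_step' r0 cDx; have iy := integrable_step' r0 cDy.
rewrite (@eq_Rintegral _ _ _ mu _ (fun z => D z * (shift_step x r)^`()%classic z -
                               D z * (shift_step y r)^`()%classic z)); last first.
  move=> z _; rewrite -mulrBr; congr (_ * _); rewrite derive1E.
  have H := is_deriveD (is_derive_shift_step x r z)
    (is_deriveM (is_derive_cst (-1 : R) z 1) (is_derive_shift_step y r z)).
  by rewrite (@derive_val _ _ _ _ _ _ _ H) /GRing.scale/= mulr0 addr0 mulN1r.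
have ixJ := integrable_supp (measurable_itv _) (measurable_itv _) subx outx ix.
have iyJ := integrable_supp (measurable_itv _) (measurable_itv _) suby outy iy.
rewrite (RintegralB _ ixJ iyJ)// => Ixy.
exact: (close_of_averages (Rintegral_supp subx outx) (Rintegral_supp suby outy) Ixy
  (step_average r0 cDx Dx) (step_average r0 cDy Dy)).
Unshelve. all: by end_near. Qed.

Lemma continuous_primitive c d v : c <= d -> mu.-integrable `]c, d[ (EFin \o v) ->
  {within `[c, d], continuous (fun x => \int[mu]_(z in `]c, x[) v z)}.
Proof.
move=> cd iv; pose w := v \_ `]c, d[.
have iw : mu.-integrable [set: R] (EFin \o w).
  rewrite /w -restrict_EFin; apply/integrable_restrict => //; by rewrite setTI.
have iw2 : mu.-integrable `[c, d] (EFin \o w) by apply: integrableS iw.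
have := parameterized_integral_continuous cd iw2.
apply: subspace_eq_continuous => x; rewrite inE/= in_itv/= => /andP[cx xd].
transitivity (\int[mu]_(z in `]c, x[) w z).
  by apply/esym/Rintegral_oo_cc; apply: integrableS iw.
apply: eq_Rintegral => z; rewrite mem_oo => /andP[cz zx].
by rewrite /w patchE mem_oo cz (lt_le_trans zx xd).
Qed.

Lemma continuous_subitv c d c' d' u : c < c' -> d' < d ->
  {in `]c, d[, continuous u} -> {within `[c', d'], continuous u}.
Proof.
move=> cc dd cu; apply: continuous_in_subspaceT => z; rewrite inE /= in_itv/= => /andP[cz zd].
by apply: cu; rewrite in_itv/= (lt_le_trans cc cz) (le_lt_trans zd).
Qed.

Lemma integrable_continuous_test c d u phi : {within `[c, d], continuous u} ->
  test_function `]c, d[ phi ->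
  mu.-integrable `]c, d[ (EFin \o (fun z => u z * phi^`()%classic z)).
Proof.
move=> cu tphi.
have : mu.-integrable `[c, d] (EFin \o (fun z => u z * phi^`()%classic z)).
  apply: continuous_compact_integrable; first exact: segment_compact.
  move=> z; apply: cvgM; first exact: cu.
  by apply: continuous_subspaceT; exact: (test_continuous' tphi).
by apply: integrableS => //; exact: subset_itv_oo_cc.
Qed.

(** On a slightly smaller interval v is integrable, so it has a primitive there,
   and the difference between u and this primitive has weak derivative 0. *)
Lemma primitive_of_weak c d u v : {in `]c, d[, continuous u} ->
  weak_derivative `]c, d[ u v ->
  forall x y, c < y -> y <= x -> x < d -> u x - u y = \int[mu]_(z in `]y, x[) v z.
Proof.
move=> cu wv x y cy yx xd.
(* A margin on both sides of [y, x] keeps the two points inside the interval on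
   which the lemma on weak derivative 0 applies. *)
pose c' := (c + y) / 2; pose d' := (x + d) / 2.
have cc' : c < c' by rewrite /c'; lra.
have c'y : c' < y by rewrite /c'; lra.
have xd' : x < d' by rewrite /d'; lra.
have d'd : d' < d by rewrite /d'; lra.
have c'd' : c' < d' by rewrite /c' /d'; lra.
have [_ wv'] := weak_derivativeS cc' d'd wv.
have iv : mu.-integrable `]c', d'[ (EFin \o v).
  by case: wv => lv _; exact: locally_integrableS_oo lv.
pose V z := \int[mu]_(t in `]c', z[) v t.
have cV : {within `[c', d'], continuous V} by exact: continuous_primitive (ltW c'd') iv.
have cuW : {within `[c', d'], continuous u} by exact: continuous_subitv cu.
have split s t : c' <= t -> t <= s -> s <= d' -> V s - V t = \int[mu]_(z in `]t, s[) v z.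
  move=> ct ts sd; rewrite /V (@Rintegral_oo_split R c' t s)//; first by rewrite addrC addKr.
  by apply: integrableS iv => //; apply: subset_itvl; rewrite bnd_simp.
have wV : weak_derivative `]c', d'[ V v.
  apply: weak_of_primitive => // s t ct ts sd; rewrite split// ltW//.
have DC : {in `]c', d'[ &, forall s t, u s - V s = u t - V t}.
  apply: (@constant_of_weak0 c' d' (fun z => u z - V z)).
    move=> z zc; apply: cvgB.
      apply: cu; move: zc; rewrite !in_itv/= => /andP[? ?].
      by apply/andP; split; lra.
    exact: (within_continuous_continuous c'd' cV zc).
  move=> phi tphi; under eq_Rintegral do rewrite mulrBl.
  rewrite RintegralB//; try exact: integrable_continuous_test.
  by rewrite wv'// (wV.2 _ tphi) subrr.
have xc : x \in `]c', d'[ by rewrite in_itv/= xd' andbT; lra.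
have yc : y \in `]c', d'[ by rewrite in_itv/= c'y/=; lra.
by have := DC x y xc yc; rewrite -(split _ _ (ltW c'y) yx (ltW xd')); lra.
Qed.

(** Lebesgue differentiation: at almost every x the primitive of h has derivative
   h x, and this primitive is constant. *)
Lemma ae0_of_intervals_integrable c d h : mu.-integrable `]c, d[ (EFin \o h) ->
  (forall x y, c < y -> y <= x -> x < d -> \int[mu]_(z in `]y, x[) h z = 0) ->
  {ae mu, forall x, x \in `]c, d[ -> h x = 0}.
Proof.
move=> ih h0; pose w := h \_ `]c, d[.
have iw : mu.-integrable [set: R] (EFin \o w).
  by rewrite /w -restrict_EFin; apply/integrable_restrict => //; rewrite setTI.
have lw : locally_integrable [set: R] w.
  by apply: open_integrable_locally => //; exact: openT.
have iwy y : mu.-integrable `]-oo, y] (EFin \o w) by apply: integrableS iw.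
have := FTC1Ny iwy lw.
apply: (@filterS _ _ (ae_filter_ringOfSetsType mu)) => x [_ Fx] xcd.
have -> : h x = w x by rewrite /w patchE mem_set.
rewrite -Fx derive1E.
set F := (X in 'D_1 X x).
rewrite (@near_eq_derive _ _ _ _ (cst (F x)) x 1) ?derive_cst//.
have FE s t : s \in `]c, d[ -> t \in `]c, d[ -> s <= t -> F t = F s.
  rewrite !in_itv/= => /andP[cs sd] /andP[ct td] st; apply/eqP; rewrite -subr_eq0 /F.
  rewrite (@Rintegral_itvB R w -oo%O (BRight t) s (iwy t))// -Rintegral_itv_bndo_bndc; last first.
    by apply: integrableS iw.
  rewrite -[X in _ == X](h0 t s cs st td); apply/eqP.
  apply: eq_Rintegral => z; rewrite mem_oo => /andP[sz zt].
  by rewrite /w patchE mem_oo (lt_trans cs sz) (lt_trans zt td).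
near=> t; have tcd : t \in `]c, d[ by near: t; exact: near_in_itvoo.
by have [tx|/ltW xt] := leP t x; [rewrite -(FE t x)|rewrite (FE x t)].
Unshelve. all: by end_near. Qed.

(** Exhausts ]c, d[ by the intervals ]c + 1/n, d - 1/n[, on which h is
   integrable. *)
Lemma ae0_of_intervals c d h : locally_integrable `]c, d[ h ->
  (forall x y, c < y -> y <= x -> x < d -> \int[mu]_(z in `]y, x[) h z = 0) ->
  {ae mu, forall x, x \in `]c, d[ -> h x = 0}.
Proof.
move=> lh h0.
pose c_ n : R := c + n.+1%:R^-1; pose d_ n : R := d - n.+1%:R^-1.
have cc n : c < c_ n by rewrite /c_ ltrDl invr_gt0 ltr0n.
have dd n : d_ n < d by rewrite /d_ gtrBl invr_gt0 ltr0n.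
have : {ae mu, forall x, forall n, x \in `]c_ n, d_ n[ -> h x = 0}.
  apply: ae_foralln => n; apply: ae0_of_intervals_integrable.
    exact: (locally_integrableS_oo (cc n) (dd n) lh).
  move=> x y cy yx xd; apply: h0 => //; first exact: lt_trans cy.
  exact: lt_trans (dd n).
apply: (@filterS _ _ (ae_filter_ringOfSetsType mu)) => x H; rewrite in_itv/= => /andP[cx xd].
pose e := Num.min (x - c) (d - x).
have e0 : 0 < e by rewrite lt_min !subr_gt0 cx.
have [n _ Hn] : \forall n \near \oo, (n.+1%:R^-1 : R) < e by exact: near_infty_natSinv_lt (PosNum e0).
apply: (H n); have := Hn n (leqnn _); rewrite /= lt_min => /andP[H1 H2].
by rewrite in_itv/= /c_ /d_ -ltrBrDl H1 ltrBrDr -ltrBrDl.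
Qed.

Lemma ae_eq_of_primitives c d v w :
  locally_integrable `]c, d[ v -> locally_integrable `]c, d[ w ->
  (forall x y, c < y -> y <= x -> x < d ->
    \int[mu]_(z in `]y, x[) v z = \int[mu]_(z in `]y, x[) w z) ->
  {ae mu, forall x, x \in `]c, d[ -> v x = w x}.
Proof.
move=> lv lw vw.
have := @ae0_of_intervals c d (fun x => v x - w x) (locally_integrableB lv lw).
have H : forall x y, c < y -> y <= x -> x < d -> \int[mu]_(z in `]y, x[) (v z - w z) = 0.
  move=> x y cy yx xd.
  have loc u : locally_integrable `]c, d[ u -> mu.-integrable `]y, x[ (EFin \o u).
    exact: locally_integrableS_oo.
  by rewrite RintegralB ?loc// vw// subrr.
move=> /(_ H); apply: (@filterS _ _ (ae_filter_ringOfSetsType mu)) => x + xcd => /(_ xcd) /eqP.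
by rewrite subr_eq0 => /eqP.
Qed.

End weak3.

(** * Integration along the inverse of an arc length *)

Section density.
Local Open Scope ereal_scope.
Context d (T : measurableType d) (R : realType).
Variable mu : {sigma_finite_measure set T -> \bar R}.

(** Integration against the measure with density G; the formula is obtained
   from the change of variables for the Radon-Nikodym derivative, which is almost
   everywhere equal to G. *)
Lemma exists_density_measure (G : T -> \bar R) : (forall x, 0 <= G x) ->
  mu.-integrable [set: T] G ->
  exists nu : {finite_measure set T -> \bar R},
    (forall A, measurable A -> nu A = \int[mu]_(x in A) G x) /\
    (forall f : T -> \bar R, (forall x, 0 <= f x) -> measurable_fun [set: T] f ->
      \int[nu]_x f x = \int[mu]_x (f x * G x)).
Proof.
move=> G0 iG; have mG := measurable_int _ iG.
pose m (A : set T) := \int[mu]_(x in A) G x.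
have m0 : m set0 = 0 by exact: integral_set0.
have m_ge0 A : 0 <= m A by exact: integral_ge0.
have m_add : semi_sigma_additive m.
  move=> A mA tA mUA.
  rewrite /m integral_bigcup//=; last exact: integrableS iG.
  by apply: is_cvg_ereal_nneg_natsum_cond => n _ _; exact: integral_ge0.
pose m_meas := isMeasure.Build _ _ _ m m0 m_ge0 m_add.
pose nu0 : {measure set T -> \bar R} := HB.pack m m_meas.
have m_fin : fin_num_fun m.
  move=> A mA; apply: integrable_fin_num => //; exact: integrableS iG.
pose nu_fin := Measure_isFinite.Build _ _ _ nu0 m_fin.
pose nu : {finite_measure set T -> \bar R} := HB.pack (Measure.sort nu0) nu_fin.
have nuE A : measurable A -> nu A = \int[mu]_(x in A) G x by [].
exists nu; split => // f f0 mf.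
have numu : nu `<< mu.
  apply/null_content_dominatesP => A mA muA.
  rewrite nuE//; by apply: null_set_integral => //; exact: measurable_funTS.
rewrite -(Radon_Nikodym_SigmaFinite.change_of_variables numu f0 measurableT mf).
set rho := Radon_Nikodym_SigmaFinite.f nu mu.
have irho : mu.-integrable [set: T] rho by exact: Radon_Nikodym_SigmaFinite.f_integrable.
have rhoG : ae_eq mu [set: T] rho G.
  apply: integral_ae_eq => // E _ mE.
  by rewrite -(Radon_Nikodym_SigmaFinite.f_integral numu)// nuE.
apply: ge0_ae_eq_integral => //.
- by apply: emeasurable_funM => //; exact: measurable_int irho.
- exact: emeasurable_funM.
- by move=> x _; rewrite mule_ge0//; exact: Radon_Nikodym_SigmaFinite.f_ge0.
- by move=> x _; rewrite mule_ge0.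
- by apply: filterS rhoG => x + _ => /(_ I) ->.
Qed.

End density.

Lemma integrable_cst_oo (R : realType) (x y k : R) :
  (@lebesgue_measure R).-integrable `]x, y[ (EFin \o cst k).
Proof.
have : (@lebesgue_measure R).-integrable `[x, y] (EFin \o cst k).
  apply: continuous_compact_integrable; first exact: segment_compact.
  by apply: continuous_subspaceT; exact: cst_continuous.
by apply: integrableS => //; exact: subset_itv_oo_cc.
Qed.

Lemma clamp_lip (R : realType) (x y l : R) : 0 < l -> x <= y ->
  Num.min (Num.max x 0) l <= Num.min (Num.max y 0) l /\
  Num.min (Num.max y 0) l - Num.min (Num.max x 0) l <= y - x.
Proof.
move=> l0 xy; have [x0|x0] := leP x 0; have [y0|y0] := leP y 0; try lra.
- by rewrite (min_l (ltW l0)); have [?|?] := leP y l; split; lra.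
- by have [?|?] := leP x l; have [?|?] := leP y l; split; lra.
Qed.

Definition arc_len (R : realType) (a : R) (g : R -> R) (x : R) : R :=
  \int[@lebesgue_measure R]_(z in `]a, x[) g z.

(** The function t is the inverse of the arc length with density g, frozen at a
   and b outside [0, L].  The density is abstract, bounded below by eps, so
   that the estimates apply along a sequence of curves and to their limit alike. *)
Definition is_arc (R : realType) (a b eps : R) (g t : R -> R) : Prop :=
  [/\ measurable_fun [set: R] g, (forall x, eps <= g x),
      (@lebesgue_measure R).-integrable `]a, b[ (EFin \o g) &
      [/\ (forall y, y < 0 -> t y = a),
          (forall y, arc_len a g b < y -> t y = b) &
          (forall y, 0 <= y -> y <= arc_len a g b ->
             a <= t y <= b /\ arc_len a g (t y) = y)]].

Section arc.
Context {R : realType}.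
Notation mu := (@lebesgue_measure R).
Variables (a b eps : R) (g t : R -> R).
Hypotheses (ab : a < b) (eps0 : 0 < eps) (arc : is_arc a b eps g t).
Notation s := (arc_len a g).
Notation L := (s b).

Let mg : measurable_fun [set: R] g. Proof. by case: arc. Qed.
Let g_ge x : eps <= g x. Proof. by case: arc. Qed.
Let ig : mu.-integrable `]a, b[ (EFin \o g). Proof. by case: arc. Qed.
Let t_lt0 y : y < 0 -> t y = a. Proof. by case: arc => _ _ _ [+ _ _]; exact. Qed.
Let t_gtL y : L < y -> t y = b. Proof. by case: arc => _ _ _ [_ + _]; exact. Qed.
Let t_in y : 0 <= y -> y <= L -> a <= t y <= b /\ s (t y) = y.
Proof. by case: arc => _ _ _ [_ _]; exact. Qed.

Lemma arc_len_diff x y : a <= x -> x <= y -> y <= b ->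
  s y - s x = \int[mu]_(z in `]x, y[) g z.
Proof.
move=> ax xy yb; rewrite /arc_len (@Rintegral_oo_split R a x y)//.
  by rewrite addrC addKr.
by apply: integrableS ig => //; apply: subset_itvl; rewrite bnd_simp.
Qed.

(** This expansion by eps is the source of every estimate on the inverse t. *)
Lemma arc_len_incr x y : a <= x -> x <= y -> y <= b -> eps * (y - x) <= s y - s x.
Proof.
move=> ax xy yb; rewrite arc_len_diff//.
have -> : eps * (y - x) = \int[mu]_(z in `]x, y[) eps.
  rewrite Rintegral_cst//= lebesgue_measure_itv/= lte_fin.
  by move: xy; rewrite le_eqVlt => /predU1P[->|->//]; rewrite ltxx subrr.
have sub : `]x, y[ `<=` `]a, b[ by apply: subset_itv; rewrite bnd_simp.
apply: le_Rintegral => //.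
- exact: integrable_cst_oo.
- by apply: integrableS ig.
Qed.

Lemma arc_len_a : s a = 0.
Proof. by rewrite /arc_len set_itvoo0 Rintegral_set0. Qed.

Lemma arc_len_le x y : a <= x -> x <= y -> y <= b -> s x <= s y.
Proof.
move=> ax xy yb; rewrite -subr_ge0; apply: le_trans (arc_len_incr ax xy yb).
by rewrite mulr_ge0 ?(ltW eps0)// subr_ge0.
Qed.

Lemma arc_len_lt x y : a <= x -> x < y -> y <= b -> s x < s y.
Proof.
move=> ax xy yb; rewrite -subr_gt0; apply: lt_le_trans (arc_len_incr ax (ltW xy) yb).
by rewrite mulr_gt0// subr_gt0.
Qed.

Lemma arc_len_b_gt0 : 0 < L.
Proof. by rewrite -arc_len_a arc_len_lt. Qed.

Lemma arc_inv_range y : a <= t y <= b.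
Proof.
have [y0|y0] := ltP y 0; first by rewrite t_lt0// lexx ltW.
by have [yL|yL] := ltP L y; [rewrite t_gtL// lexx ltW|have [] := t_in y0 yL].
Qed.

(** Since t is frozen outside [0, L], the arc length at t y is y clamped to
   [0, L]. *)
Lemma arc_len_inv y : s (t y) = Num.min (Num.max y 0) L.
Proof.
have [y0|y0] := ltP y 0.
  by rewrite t_lt0// arc_len_a min_l// ltW ?arc_len_b_gt0.
have [yL|yL] := ltP L y; first by rewrite t_gtL.
by have [_ ->] := t_in y0 yL.
Qed.

Lemma arc_len_inv_mono x y : x <= y -> s (t x) <= s (t y) /\ s (t y) - s (t x) <= y - x.
Proof.
by rewrite !arc_len_inv; apply: clamp_lip; exact: arc_len_b_gt0.
Qed.

Lemma arc_inv_mono x y : x <= y -> t x <= t y.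
Proof.
move=> xy; rewrite leNgt; apply/negP => H.
have /andP[ax xb] := arc_inv_range x; have /andP[ay yb] := arc_inv_range y.
by have := arc_len_lt ay H xb; rewrite ltNge; have [->] := arc_len_inv_mono xy.
Qed.

Lemma arc_inv_lip_le x y : x <= y -> t y - t x <= (y - x) / eps.
Proof.
move=> xy; have /andP[ax xb] := arc_inv_range x; have /andP[ay yb] := arc_inv_range y.
have := arc_len_incr ax (arc_inv_mono xy) yb; have [_ H] := arc_len_inv_mono xy.
by move=> H2; rewrite ler_pdivlMr// mulrC (le_trans H2).
Qed.

Lemma arc_inv_lip x y : `|t y - t x| <= `|y - x| / eps.
Proof.
have [xy|/ltW yx] := leP x y.
  by rewrite !ger0_norm ?subr_ge0// ?arc_inv_mono// arc_inv_lip_le.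
rewrite distrC [X in X / _]distrC.
by rewrite !ger0_norm ?subr_ge0// ?arc_inv_mono// arc_inv_lip_le.
Qed.

Lemma arc_inv_continuous : continuous t.
Proof.
move=> x; apply/cvgrPdist_le => e e0; near=> y.
apply: (le_trans (arc_inv_lip _ _)); rewrite ler_pdivrMr//.
near: y; apply: cvgr_dist_le => //; exact: mulr_gt0.
Unshelve. all: by end_near. Qed.

Lemma arc_inv_measurable : measurable_fun [set: R] t.
Proof. by apply: continuous_measurable_fun; exact: arc_inv_continuous. Qed.

Lemma arc_gt x y : a <= x <= b -> 0 < y < L -> (x < t y) = (s x < y).
Proof.
move=> /andP[ax xb] /andP[y0 yL].
have [/andP[at_ tb] E] := t_in (ltW y0) (ltW yL).
rewrite -{2}E; apply/idP/idP => H; first exact: arc_len_lt.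
by rewrite ltNge; apply/negP => H2; move: H; rewrite ltNge arc_len_le.
Qed.

Lemma arc_lt x y : a <= x <= b -> 0 < y < L -> (t y < x) = (y < s x).
Proof.
move=> /andP[ax xb] /andP[y0 yL].
have [/andP[at_ tb] E] := t_in (ltW y0) (ltW yL).
rewrite -{2}E; apply/idP/idP => H; first exact: arc_len_lt.
by rewrite ltNge; apply/negP => H2; move: H; rewrite ltNge arc_len_le.
Qed.

Lemma arc_preimage_ray x : `]0, L[%classic `&` [set y | x < t y] =
  `]s (Num.min (Num.max x a) b), L[%classic.
Proof.
have L0 := arc_len_b_gt0.
apply/seteqP; split => y /=; rewrite !in_itv/=.
  move=> [/andP[y0 yL] xt]; rewrite yL andbT.
  rewrite -(@arc_gt _ y) ?y0//; last first.
    by rewrite le_min le_max lexx orbT (ltW ab)/= ge_min lexx orbT.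
  have [_ E] := t_in (ltW y0) (ltW yL); have /andP[at_ tb] := arc_inv_range y.
  have ta : a < t y.
    by rewrite lt_neqAle at_ andbT; apply: contraTneq y0 => ta; rewrite -E -ta arc_len_a ltxx.
  by rewrite gt_min gt_max xt ta.
set x' := Num.min _ _ => /andP[sy yL].
have x'ab : a <= x' <= b.
  by rewrite le_min le_max lexx orbT (ltW ab)/= ge_min lexx orbT.
have y0 : 0 < y by apply: le_lt_trans sy; rewrite -arc_len_a; case/andP: x'ab => *; exact: arc_len_le.
rewrite y0 yL; split => //.
have : x' < t y by rewrite arc_gt// y0.
have [_ E] := t_in (ltW y0) (ltW yL); have /andP[at_ tb] := arc_inv_range y.
by rewrite gt_min gt_max => /orP[/andP[]//|]; rewrite ltNge tb.
Qed.

(** The image under t of the Lebesgue measure on ]0, L[ is the measure with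
   density g on ]a, b[.  The two measures agree on rays ]x, +oo[, where both have
   mass s b - s x for x in [a, b], and rays generate the Borel sets. *)
Lemma arc_change_of_variables (f : R -> \bar R) : (forall x, 0 <= f x)%E ->
  measurable_fun [set: R] f ->
  (\int[mu]_(y in `]0%R, L[) f (t y) = \int[mu]_(x in `]a, b[) (f x * (g x)%:E))%E.
Proof.
move=> f0 mf; have L0 := arc_len_b_gt0.
pose T := measurableTypeR R.
pose G : T -> \bar R := (EFin \o g) \_ `]a, b[.
have G0 x : (0 <= G x)%E.
  by rewrite /G patchE; case: ifP => // _; rewrite lee_fin (le_trans _ (g_ge x))// ltW.
have iG : mu.-integrable [set: T] G.
  by apply/integrable_restrict => //; rewrite setTI.
pose D : T -> \bar R := fun x => (\1_(`]0, L[%classic : set R) x)%:E.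
have D0 x : (0 <= D x)%E by rewrite lee_fin.
have iD : mu.-integrable [set: T] D.
  exact: integrable_indic_itv.
have [nu [nuE nuI]] := exists_density_measure G0 iG.
have [m1 [m1E m1I]] := exists_density_measure D0 iD.
have mt' : measurable_fun [set: T] (t : T -> T) := arc_inv_measurable.
have mf' : measurable_fun [set: T] (f : T -> \bar R) := mf.
pose nu' := measure_function_pushforward__canonical__measure_function_Measure m1 mt'.
have m1A A : measurable (A : set T) -> m1 A = mu (A `&` `]0, L[%classic).
  by move=> mA; rewrite m1E// integral_indic// setIC.
have mtA A : measurable (A : set T) -> measurable (t @^-1` A : set T).
  by move=> mA; rewrite -[X in measurable X]setTI; exact: (mt' measurableT A mA).
have same : forall A, measurable (A : set T) -> nu' A = nu A.
  apply: (@measure_unique _ R T (@RGenOInfty.G R)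
    (fun k => `](- k%:R)%R, +oo[%classic) _ _ _ _ nu' nu).
  - exact: RGenOInfty.measurableE.
  - move=> _ _ [x ->] [y ->]; exists (Num.max x y).
    by apply/seteqP; split => z /=; rewrite !in_itv/= !andbT gt_max; [move=> [-> ->]|move=> /andP[]].
  - by move=> k; exists (- k%:R).
  - apply/seteqP; split => // x _; exists (Num.truncn `|x|).+1 => //=.
    rewrite in_itv/= andbT ltrNl (le_lt_trans _ (truncnS_gt _))//.
    by rewrite -normrN ler_norm.
  - move=> _ [x ->]; rewrite [LHS]m1A; last first.
      by apply: mtA; exact: measurable_itv.
    rewrite [X in mu X](_ : _ = `]s (Num.min (Num.max x a) b), L[%classic); last first.
      rewrite -arc_preimage_ray setIC; congr (_ `&` _).
      by apply/seteqP; split => y /=; rewrite in_itv/= andbT.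
    set x' := Num.min _ _.
    have /andP[ax' x'b] : a <= x' <= b.
      by rewrite le_min le_max lexx orbT (ltW ab)/= ge_min lexx orbT.
    apply/esym; apply: (etrans (nuE _ _)); first exact: measurable_itv.
    rewrite -integral_mkcondr (_ : _ `&` _ = `]x', b[%classic); last first.
      apply/seteqP; split => z /=; rewrite !in_itv/= andbT.
        by move=> [xz /andP[az ->]]; rewrite andbT gt_min gt_max xz az.
      move=> /andP[]; rewrite gt_min gt_max => /orP[/andP[-> ->] ->//|].
      by move=> /lt_trans H /H; rewrite ltxx.
    rewrite -EFin_Rintegral//; last first.
      by apply: integrableS ig => //; apply: subset_itvr; rewrite bnd_simp.
    rewrite -arc_len_diff// /= lebesgue_measure_itv/= lte_fin -EFinD.
    case: ifPn => //; rewrite -leNgt => H; congr EFin; apply/eqP.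
    by rewrite subr_eq0 eq_le H arc_len_le.
  - move=> k; rewrite [X in (X < _)%E]m1A; last first.
      by apply: mtA; exact: measurable_itv.
    apply: (@le_lt_trans _ _ (mu `]0, L[%classic)).
      apply: le_measure => //; rewrite inE; last exact: measurable_itv.
      apply: measurableI; last exact: measurable_itv.
      by apply: mtA; exact: measurable_itv.
    by rewrite /= lebesgue_measure_itv/= lte_fin L0 -EFinD ltry.
have E1 : (\int[nu']_x f x = \int[nu]_x f x)%E.
  by apply: eq_measure_integral => A mA _; exact: same.
move: E1; rewrite nuI// [LHS]ge0_integral_pushforward// preimage_setT m1I; last 2 first.
- by move=> x /=.
- exact: (measurableT_comp mf' arc_inv_measurable).
move=> E1; rewrite integral_mkcond [RHS]integral_mkcond.
transitivity (\int[mu]_x ((f \o t) x * D x))%E.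
  apply: eq_integral => y _; rewrite /D patchE indicE.
  by case: ifP => _ /=; rewrite ?mule1 ?mule0.
rewrite E1; apply: eq_integral => x _; rewrite /G !patchE.
by case: ifP => _ //=; rewrite mule0.
Qed.

Lemma arc_gt0 x : 0 < g x.
Proof. exact: lt_le_trans (g_ge x). Qed.

Variables (M : R) (w G : R -> R).
Hypotheses (mw : measurable_fun [set: R] w) (wM : forall x, `|w x| <= M * g x).
Hypothesis Gw : forall x y, a <= y -> y <= x -> x <= b ->
  G x - G y = \int[mu]_(z in `]y, x[) w z.

(** The derivative of G o t when w is that of G. *)
Definition arc_rate (y : R) : R :=
  if (0 < y) && (y < L) then w (t y) / g (t y) else 0.

Let M0 : 0 <= M.
Proof.
have := le_trans (normr_ge0 _) (wM a); rewrite pmulr_lge0//; exact: arc_gt0.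
Qed.

Let wgM x : `|w x / g x| <= M.
Proof.
rewrite normrM normfV (gtr0_norm (arc_gt0 x)) ler_pdivrMr ?arc_gt0//.
Qed.

Let mwg : measurable_fun [set: R] (fun x => w x / g x).
Proof.
apply: measurable_funM => //.
have oU : open [set x : R | x != 0] by exact: open_neq.
apply: (@measurable_comp _ _ _ _ _ _ [set x : R | x != 0] (@GRing.inv R) setT g) => //.
- exact: open_measurable.
- by move=> _ [x _ <-] /=; rewrite gt_eqF// arc_gt0.
- apply: open_continuous_measurable_fun => //.
  by move=> x; rewrite inE; exact: inv_continuous.
Qed.

Lemma measurable_div_arc : measurable_fun [set: R] (fun x => w x / g x).
Proof. exact: mwg. Qed.

Lemma arc_rate_le y : `|arc_rate y| <= M.
Proof. by rewrite /arc_rate; case: ifP => // _; rewrite normr0. Qed.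

Lemma arc_rate_measurable : measurable_fun [set: R] arc_rate.
Proof.
apply: measurable_fun_ifT => //.
  by apply: measurable_and; apply: measurable_fun_ltr.
exact: (measurableT_comp mwg arc_inv_measurable).
Qed.

Lemma arc_rate_integrable x y : mu.-integrable `]x, y[ (EFin \o arc_rate).
Proof.
rewrite (_ : arc_rate = (fun z => arc_rate z * cst 1 z)); last first.
  by apply/funext => z; rewrite mulr1.
apply: (integrable_bounded_mul (M := M)) => //.
- by apply: measurable_funTS; exact: arc_rate_measurable.
- by move=> z _; exact: arc_rate_le.
- exact: integrable_cst_oo.
Qed.

(** The chain rule in integrated form.  The change of variables holds for
   nonnegative functions, hence it is applied to w / g + M, cut to ]t x, t y[, and
   the contribution of M is the same on both sides. *)
Lemma arc_rate_primitive x y : x <= y ->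
  G (t y) - G (t x) = \int[mu]_(z in `]x, y[) arc_rate z.
Proof.
move=> xy; have txy := arc_inv_mono xy; have [sxy _] := arc_len_inv_mono xy.
have /andP[atx _] := arc_inv_range x; have /andP[_ tyb] := arc_inv_range y.
set x' := s (t x); set y' := s (t y).
transitivity (\int[mu]_(z in `]x', y'[) arc_rate z); last first.
  rewrite Rintegral_mkcond [RHS]Rintegral_mkcond; congr Rintegral.
  apply/funext => z; rewrite !patchE !mem_oo /arc_rate.
  have [/andP[z0 zL]|_] := boolP ((0 < z) && (z < L)); last by case: ifP; case: ifP.
  rewrite /x' /y' !arc_len_inv gt_min gt_max z0 andbT lt_min zL andbT lt_max.
  by rewrite [_ < 0]ltNge [L < _]ltNge (ltW z0) (ltW zL)/= !orbF.
have wi : mu.-integrable `]a, b[ (EFin \o w).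
  have H : mu.-integrable `]a, b[ (fun x => (M%:E * (EFin \o g) x)%E) by exact: integrableZl.
  apply: le_integrable H => //; first by apply/measurable_EFinP; exact: measurable_funTS.
  move=> z _ /=; rewrite lee_fin (le_trans (wM z))// ler_norm//.
(* The summand M makes the function nonnegative. *)
pose h z : \bar R := ((w z / g z + M) * \1_(`]t x, t y[%classic : set R) z)%:E.
have h0 z : (0 <= h z)%E.
  rewrite lee_fin mulr_ge0//; have := wgM z; rewrite ler_norml => /andP[+ _].
  by rewrite -subr_ge0 opprK.
have mh : measurable_fun [set: R] h.
  by apply/measurable_EFinP; apply: measurable_funM => //; apply: measurable_funD.
have := arc_change_of_variables h0 mh.
have -> : (\int[mu]_(z in `]0%R, L[) h (t z) =
    \int[mu]_(z in `]x', y'[) (arc_rate z + M)%:E)%E.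
  rewrite integral_mkcond [RHS]integral_mkcond; apply: eq_integral => z _.
  rewrite !patchE !mem_oo /h indicE mem_oo /arc_rate.
  have [z0L|z0L] := boolP ((0 < z) && (z < L)).
    rewrite arc_gt ?arc_inv_range// arc_lt ?arc_inv_range// -/x' -/y'.
    by case: ifP; rewrite ?mulr1 ?mulr0.
  case: ifP => // /andP[xz zy]; case/negP: z0L.
  have L0 := arc_len_b_gt0; move: xz zy; rewrite /x' /y' !arc_len_inv gt_min lt_min.
  move=> + /andP[_ zL]; rewrite zL [L < _]ltNge (ltW zL) orbF andbT gt_max.
  by move=> /andP[].
have -> : (\int[mu]_(z in `]a, b[) (h z * (g z)%:E) =
    \int[mu]_(z in `]t x, t y[) (w z + M * g z)%:E)%E.
  rewrite integral_mkcond [RHS]integral_mkcond; apply: eq_integral => z _.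
  rewrite !patchE !mem_oo /h indicE mem_oo.
  have [/andP[xz zy]|_] := boolP ((t x < z) && (z < t y)).
    rewrite (le_lt_trans atx xz) (lt_le_trans zy tyb)/= mulr1 -EFinM; congr EFin.
    by rewrite mulrDl divfK// gt_eqF// arc_gt0.
  by rewrite mulr0 mul0e; case: ifP.
have iwt : mu.-integrable `]t x, t y[ (EFin \o w).
  by apply: integrableS wi => //; apply: subset_itv; rewrite bnd_simp.
have igt : mu.-integrable `]t x, t y[ (EFin \o (fun z => M * g z)).
  have : mu.-integrable `]t x, t y[ (EFin \o g).
    by apply: integrableS ig => //; apply: subset_itv; rewrite bnd_simp.
  exact: integrableZl.
have igg : mu.-integrable `]t x, t y[ (EFin \o g).
  by apply: integrableS ig => //; apply: subset_itv; rewrite bnd_simp.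
move=> /(congr1 fine); rewrite -/(Rintegral _ _ _) -/(Rintegral _ _ _).
rewrite RintegralD//; [|exact: arc_rate_integrable|exact: integrable_cst_oo].
rewrite RintegralD// RintegralZl// -arc_len_diff// -/x' -/y' -Gw//.
rewrite Rintegral_cst//= lebesgue_measure_itv/= lte_fin.
have -> : fine (if (x' < y')%R then y'%:E - x'%:E else 0%R)%E = y' - x'.
  by move: sxy; rewrite -/x' -/y' le_eqVlt => /predU1P[->|->//]; rewrite ltxx subrr.
by move=> /addIr.
Qed.

End arc.

(** * Comparison of two reparameterizations *)

Section close.
Context {R : realType}.
Notation mu := (@lebesgue_measure R).

Lemma le_integral_add (D : set R) (u v1 v2 : R -> R) : measurable D ->
  measurable_fun [set: R] u -> measurable_fun [set: R] v1 -> measurable_fun [set: R] v2 ->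
  (forall x, D x -> 0 <= u x) -> (forall x, D x -> 0 <= v1 x) -> (forall x, D x -> 0 <= v2 x) ->
  (forall x, D x -> u x <= v1 x + v2 x) ->
  (\int[mu]_(x in D) (u x)%:E <=
   \int[mu]_(x in D) (v1 x)%:E + \int[mu]_(x in D) (v2 x)%:E)%E.
Proof.
move=> mD mu_ mv1 mv2 u0 v10 v20 uv.
have mE h : measurable_fun [set: R] h -> measurable_fun D (EFin \o h).
  by move=> mh; apply/measurable_EFinP; exact: measurable_funTS.
rewrite -ge0_integralD//; [|exact: mE|exact: mE].
apply: ge0_le_integral => //; first exact: mE.
- by apply: emeasurable_funD; exact: mE.
Qed.

Lemma integrable_subR (D : set R) (u v : R -> R) : measurable D ->
  mu.-integrable D (EFin \o u) -> mu.-integrable D (EFin \o v) ->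
  mu.-integrable D (EFin \o (fun x => u x - v x)).
Proof.
move=> mD iu iv; have : mu.-integrable D ((EFin \o u) \- (EFin \o v))%E by exact: integrableB.
by apply: eq_integrable => // x _ /=; rewrite EFinB.
Qed.

Variables (a b eps : R).
Hypotheses (ab : a < b) (eps0 : 0 < eps).

Lemma arc_len_close (g1 g2 t1 t2 : R -> R) (e : R) :
  is_arc a b eps g1 t1 -> is_arc a b eps g2 t2 ->
  (\int[mu]_(x in `]a, b[) `|g1 x - g2 x|%:E <= e%:E)%E ->
  forall x, a <= x <= b -> `|arc_len a g1 x - arc_len a g2 x| <= e.
Proof.
move=> [mg1 _ ig1 _] [mg2 _ ig2 _] H x /andP[ax xb].
have sub : `]a, x[ `<=` `]a, b[ by apply: subset_itvl; rewrite bnd_simp.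
have i1 : mu.-integrable `]a, x[ (EFin \o g1) by apply: integrableS ig1.
have i2 : mu.-integrable `]a, x[ (EFin \o g2) by apply: integrableS ig2.
have i12 : mu.-integrable `]a, x[ (EFin \o (fun x => g1 x - g2 x)) by exact: integrable_subR.
rewrite /arc_len -RintegralB//; apply: le_trans (le_normr_Rintegral _ i12) _ => //.
rewrite -lee_fin EFin_Rintegral//; last exact: integrable_norm i12.
apply: le_trans H; apply: ge0_subset_integral => //.
by apply/measurable_EFinP; apply: measurable_funTS; apply: measurableT_comp => //; exact: measurable_funB.
Qed.

(** If t1 y <= t2 y and 0 <= y <= L1, expansion by eps bounds eps (t2 y - t1 y) by the increment of
   the second arc length; that arc length is at most y at t2 y, and e-close
   to the first one, whose value is y, at t1 y. *)
Lemma arc_inv_close (g1 g2 t1 t2 : R -> R) (e : R) :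
  is_arc a b eps g1 t1 -> is_arc a b eps g2 t2 ->
  (forall x, a <= x <= b -> `|arc_len a g1 x - arc_len a g2 x| <= e) ->
  forall y, `|t1 y - t2 y| <= e / eps.
Proof.
suff W h1 h2 u1 u2 y : is_arc a b eps h1 u1 -> is_arc a b eps h2 u2 ->
    (forall x, a <= x <= b -> `|arc_len a h1 x - arc_len a h2 x| <= e) ->
    u1 y <= u2 y -> u2 y - u1 y <= e / eps.
  move=> A1 A2 H y; have [le12|/ltW le21] := leP (t1 y) (t2 y).
    by rewrite distrC ger0_norm ?subr_ge0// (W _ _ _ _ _ A1 A2 H).
  rewrite ger0_norm ?subr_ge0// (W _ _ _ _ _ A2 A1)// => x /H.
  by rewrite distrC.
move=> A1 A2 H u12.
have /andP[au1 u1b] := arc_inv_range ab A1 y; have /andP[au2 u2b] := arc_inv_range ab A2 y.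
have e0 : 0 <= e by apply: le_trans (H a _) => //; rewrite lexx ltW.
(* Beyond the first length u1 y = b, and then u2 y = b too. *)
have [yL|Ly] := leP y (arc_len a h1 b); last first.
  have E1 : u1 y = b by case: A1 => _ _ _ [_ + _]; exact.
  have -> : u2 y = u1 y by apply/eqP; rewrite eq_le u12 E1 u2b.
  by rewrite subrr divr_ge0// ltW.
have := arc_len_incr A2 au1 u12 u2b; rewrite ler_pdivlMr// mulrC => /le_trans; apply.
have := H (u1 y); rewrite au1 u1b => /(_ isT); rewrite ler_norml => /andP[_].
rewrite (arc_len_inv ab eps0 A1) (arc_len_inv ab eps0 A2) (min_l (y := arc_len a h1 b)); last first.
  by rewrite ge_max yL ltW// (arc_len_b_gt0 ab eps0 A1).
move=> H1.
have : Num.min (Num.max y 0) (arc_len a h2 b) <= Num.max y 0 by rewrite ge_min lexx.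
by move: H1; move: (Num.max y 0) (Num.min _ _) (arc_len _ _ _) => p q r; lra.
Qed.

(** Both rates are compared with rho along t1 and t2.  After the change of
   variables the errors are the two weighted integrals over ]a, b[.  The points
   where only one rate vanishes lie between the two lengths, hence in the window
   of width 2 eta around the second length, where the rates are bounded by M. *)
Lemma rate_close (g1 g2 t1 t2 w1 w2 rho : R -> R) (M e1 e2 e3 eta : R) :
  is_arc a b eps g1 t1 -> is_arc a b eps g2 t2 ->
  measurable_fun [set: R] w1 -> measurable_fun [set: R] w2 ->
  (forall x, `|w1 x| <= M * g1 x) -> (forall x, `|w2 x| <= M * g2 x) ->
  continuous rho -> (forall x, `|rho x| <= M) -> 0 <= e3 -> 0 <= eta ->
  (\int[mu]_(x in `]a, b[) (`|w1 x / g1 x - rho x| * g1 x)%:E <= e1%:E)%E ->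
  (\int[mu]_(x in `]a, b[) (`|w2 x / g2 x - rho x| * g2 x)%:E <= e2%:E)%E ->
  (forall y, `|rho (t1 y) - rho (t2 y)| <= e3) ->
  `|arc_len a g1 b - arc_len a g2 b| <= eta ->
  (\int[mu]_y `|arc_rate a b g1 t1 w1 y - arc_rate a b g2 t2 w2 y|%:E <=
   (e1 + e2 + (e3 * arc_len a g2 b + M * (2 * eta)))%:E)%E.
Proof.
move=> A1 A2 mw1 mw2 wM1 wM2 crho rhoM e30 eta0 H1 H2 H3 H4.
set L1 := arc_len a g1 b; set L2 := arc_len a g2 b.
have M0 : 0 <= M by exact: le_trans (rhoM 0).
have mrho : measurable_fun [set: R] rho by exact: continuous_measurable_fun.
have mr1 := arc_rate_measurable ab eps0 A1 mw1.
have mr2 := arc_rate_measurable ab eps0 A2 mw2.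
pose f (g w : R -> R) x := `|w x / g x - rho x|.
have mf g w t : is_arc a b eps g t -> measurable_fun [set: R] w -> measurable_fun [set: R] (f g w).
  move=> A mw; apply: measurableT_comp => //; apply: measurable_funB => //.
  exact: (measurable_div_arc eps0 A).
pose F (L : R) (g w t : R -> R) y := f g w (t y) * \1_(`]0, L[%classic : set R) y.
have mF g w t L : is_arc a b eps g t -> measurable_fun [set: R] w ->
    measurable_fun [set: R] (F L g w t).
  move=> A mw; apply: measurable_funM; last exact: measurable_indic.
  exact: (measurableT_comp (mf _ _ _ A mw) (arc_inv_measurable ab eps0 A)).
have F0 g w t L y : 0 <= F L g w t y by rewrite mulr_ge0 ?normr_ge0// indicE ler0n.
have IF g w t : is_arc a b eps g t -> measurable_fun [set: R] w ->
    (\int[mu]_y (F (arc_len a g b) g w t y)%:E =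
     \int[mu]_(x in `]a, b[) (`|w x / g x - rho x| * g x)%:E)%E.
  move=> A mw; rewrite -[RHS](arc_change_of_variables ab eps0 A (f := EFin \o f g w))//.
    rewrite [RHS]integral_mkcond; apply: eq_integral => y _.
    by rewrite patchE /F indicE; case: ifP => _; rewrite ?mulr1 ?mulr0.
  - by move=> x /=; rewrite lee_fin normr_ge0.
  - by apply/measurable_EFinP; exact: mf A mw.
(* First term: rho moves by at most e3 between t1 y and t2 y.  Second term:
   the points between the two lengths. *)
pose B y := e3 * \1_(`]0, L2[%classic : set R) y +
            M * \1_(`[L2 - eta, L2 + eta]%classic : set R) y.
have mB : measurable_fun [set: R] B.
  by apply: measurable_funD; apply: measurable_funM => //; exact: measurable_indic.
have B0 y : 0 <= B y by rewrite addr_ge0// mulr_ge0// indicE ler0n.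
have key y : `|arc_rate a b g1 t1 w1 y - arc_rate a b g2 t2 w2 y| <=
    (F L1 g1 w1 t1 y + F L2 g2 w2 t2 y) + B y.
  have := H4; rewrite -/L1 -/L2 ler_norml => /andP[Ha Hb].
  have r1 := arc_rate_le eps0 A1 wM1; have r2 := arc_rate_le eps0 A2 wM2.
  rewrite /arc_rate /F /B /f -/L1 -/L2 !indicE !mem_oo.
  have := H3 y.
  have -> : (y \in `[L2 - eta, L2 + eta]%classic) = (L2 - eta <= y <= L2 + eta).
    by apply/idP/idP; rewrite inE/= in_itv.
  move: (w1 (t1 y) / _) (w2 (t2 y) / _) (rho (t1 y)) (rho (t2 y)) (rhoM (t1 y)) (rhoM (t2 y)) => p q x z xM zM xz.
  case: (boolP (0 < y)) => y0 /=; last by rewrite !(mulr0n, mulr0, add0r, subrr, oppr0, normr0) mulr_ge0// ler0n.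
  case: (ltP y L1) => yL1 /=; case: (ltP y L2) => yL2 /=.
  - rewrite !(mulr1n, mulr1); apply: (@le_trans _ _ (`|p - x| + `|q - z| + e3)).
      have -> : p - q = (p - x) + (x - z) - (q - z) by lra.
      rewrite (le_trans (ler_normB _ _))// (le_trans (lerD (ler_normD _ _) (lexx _)))//; lra.
    by rewrite lerD2l lerDl mulr_ge0// ler0n.
  - have -> : L2 - eta <= y <= L2 + eta by apply/andP; split; lra.
    rewrite !(mulr0n, mulr1n, mulr1, mulr0, addr0, subr0, add0r) -[X in `|X|](subrK x) (le_trans (ler_normD _ _))//; lra.
  - have -> : L2 - eta <= y <= L2 + eta by apply/andP; split; lra.
    rewrite !(mulr0n, mulr1n, mulr1, mulr0, addr0, sub0r, add0r, normrN) -[X in `|X|](subrK z) (le_trans (ler_normD _ _))//; lra.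
  - by rewrite !(mulr0n, mulr0, add0r, subrr, oppr0, normr0) mulr_ge0// ler0n.
have mr12 : measurable_fun [set: R] (fun y => `|arc_rate a b g1 t1 w1 y - arc_rate a b g2 t2 w2 y|).
  by apply: measurableT_comp => //; exact: measurable_funB.
apply: (@le_trans _ _ (\int[mu]_y (F L1 g1 w1 t1 y + F L2 g2 w2 t2 y)%:E + \int[mu]_y (B y)%:E)%E).
  apply: le_integral_add => //; [|by move=> y _; rewrite addr_ge0].
  by apply: measurable_funD; [exact: mF A1 mw1|exact: mF A2 mw2].
rewrite [leRHS]EFinD; apply: leeD.
  rewrite EFinD; apply: le_trans (leeD H1 H2).
  rewrite -(IF _ _ _ A1 mw1) -(IF _ _ _ A2 mw2); apply: le_integral_add => //.
  - by apply: measurable_funD; [exact: mF A1 mw1|exact: mF A2 mw2].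
  - exact: mF A1 mw1.
  - exact: mF A2 mw2.
  - by move=> y _; rewrite addr_ge0.
have mi (k : R) (A : set R) : measurable A -> measurable_fun [set: R] (fun y => k * \1_A y).
  by move=> mA; apply: measurable_funM => //; exact: measurable_indic.
have Ii (k l h : R) (c0 c1 : bool) : 0 <= k -> l <= h ->
  (\int[mu]_y (k * \1_([set` Interval (BSide c0 l) (BSide c1 h)] : set R) y)%:E = (k * (h - l))%:E)%E.
  move=> k0 lh; under eq_integral do rewrite EFinM.
  rewrite ge0_integralZl_EFin//; last by apply/measurable_EFinP; exact: measurable_indic.
  rewrite integral_indic//= setIT lebesgue_measure_itv/= lte_fin.
  by move: lh; rewrite le_eqVlt => /predU1P[->|->//]; rewrite ltxx subrr mule0 mulr0.
apply: (@le_trans _ _ (\int[mu]_y (e3 * \1_(`]0, L2[%classic : set R) y)%:E +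
   \int[mu]_y (M * \1_(`[L2 - eta, L2 + eta]%classic : set R) y)%:E)%E).
  by apply: le_integral_add => //; try (by apply: mi); move=> y _; rewrite mulr_ge0// indicE ler0n.
have L20 : 0 <= L2 by apply: ltW; exact: (arc_len_b_gt0 ab eps0 A2).
rewrite !Ii//; last lra.
by rewrite -EFinD subr0 lee_fin lerD2l ler_wpM2l//; lra.
Qed.

End close.

(** * Limits of reparameterizations *)

Section cvg0.
Context {R : realType}.

Lemma cvge0_le (u : nat -> \bar R) (e : R) : u n @[n --> \oo] --> 0%E -> 0 < e ->
  \forall n \near \oo, (u n <= e%:E)%E.
Proof.
move=> cu e0.
have : \forall n \near \oo, (u n < e%:E)%E.
  by apply: (cu [set y | (y < e%:E)%E]); apply: open_ereal_lt'; rewrite lte_fin.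
by apply: filterS => n /ltW.
Qed.

Lemma le_cvge0 (u : nat -> \bar R) : (forall n, 0 <= u n)%E ->
  (forall e : R, 0 < e -> \forall n \near \oo, (u n <= e%:E)%E) ->
  u n @[n --> \oo] --> 0%E.
Proof.
move=> u0 H; have fin : \forall n \near \oo, u n \is a fin_num.
  apply: filterS (H 1 ltr01) => n un.
  by rewrite ge0_fin_numE// (le_lt_trans un) ?ltry.
apply/fine_cvgP; split => //; apply/cvgrPdist_le => e e0.
near=> n; rewrite sub0r normrN ger0_norm; last by rewrite fine_ge0.
rewrite -lee_fin fineK; first by near: n; exact: H.
by near: n.
Unshelve. all: by end_near. Qed.

End cvg0.

Section limit.
Context {R : realType}.
Notation mu := (@lebesgue_measure R).
Variables (a b eps : R).
Hypotheses (ab : a < b) (eps0 : 0 < eps).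

(** Only x is confined to [a, b]: the conclusion reaches slightly beyond the
   interval. *)
Lemma uniform_continuity_itv (rho : R -> R) (e : R) : continuous rho -> 0 < e ->
  exists2 d, 0 < d & forall x y, a <= x <= b -> `|x - y| <= d -> `|rho x - rho y| <= e.
Proof.
move=> crho e0.
have /compact_near_coveringP cov := @segment_compact R a b.
have : \forall d \near ((0:R)^'+), forall x, `[a, b]%classic x ->
    forall y, `|x - y| <= d -> `|rho x - rho y| <= e.
  apply: (cov _ ((0:R)^'+) (fun d x => forall y, `|x - y| <= d -> `|rho x - rho y| <= e)) => x _.
  have e20 : 0 < e / 2 by rewrite divr_gt0.
  have /cvgrPdist_le/(_ _ e20)/nbhs_ballP[r /= r0 Hr] := crho x.
  have r20 : 0 < r / 2 by rewrite divr_gt0.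
  exists (ball x (r / 2), [set d | d < r / 2]).
    by split; [exact: nbhsx_ballx|exact: nbhs_right_lt].
  move=> [z d] [/= xz dr] y zy.
  have H1 : `|rho x - rho z| <= e / 2.
    by apply: Hr; apply: le_ball xz; lra.
  have H2 : `|rho x - rho y| <= e / 2.
    apply: Hr; move: xz; rewrite /ball/= => xz.
    rewrite -[_ - _](subrKA z) (le_lt_trans (ler_normD _ _))//; lra.
  rewrite -[_ - _](subrKA (rho x)) (le_trans (ler_normD _ _))// distrC; lra.
move=> H; near ((0:R)^'+) => d; exists d => // x y xab; apply: (near H d) => //.
Unshelve. all: by end_near. Qed.

(** Clamping w0 to [-q, q] costs no more than the failure of w itself to lie in
   that interval. *)
Lemma clamp_close (w w0 p q : R) : `|w| <= p -> 0 <= q ->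
  `|w - Num.max (- q) (Num.min w0 q)| <= `|w - w0| + `|p - q|.
Proof.
rewrite ler_norml => /andP[H1 H2] q0.
have A1 : w - w0 <= `|w - w0| by exact: ler_norm.
have A2 : w0 - w <= `|w - w0| by rewrite distrC ler_norm.
have B1 : p - q <= `|p - q| by exact: ler_norm.
have B2 : 0 <= `|p - q| by exact: normr_ge0.
have [h1|h1] := leP w0 q.
  by have [h2|h2] := leP (- q) w0; rewrite ler_norml; apply/andP; split; lra.
by rewrite max_r; [rewrite ler_norml; apply/andP; split; lra|lra].
Qed.

Lemma ratio_close (w g W K M : R) : 0 < g -> 0 < K -> `|W / K| <= M ->
  `|w / g - W / K| * g <= `|w - W| + M * `|g - K|.
Proof.
move=> g0 K0 WK; rewrite -{2}(gtr0_norm g0) -normrM.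
have -> : (w / g - W / K) * g = (w - W) - W / K * (g - K).
  by field; rewrite !gt_eqF.
rewrite (le_trans (ler_normB _ _))// lerD2l normrM ler_wpM2r//.
Qed.

(** A continuous stand-in for w / g, chosen once and for all from the limit data: the
   quotient of continuous L^1 approximations of w and g, truncated so that the
   denominator stays above eps and the quotient stays within [-M, M].  The error
   weighted by g' is controlled by the L^1 distances of w' to w and g' to g. *)
Lemma approx_rate (g t w : R -> R) (M e : R) : is_arc a b eps g t ->
  measurable_fun [set: R] w -> (forall x, `|w x| <= M * g x) -> 0 < e ->
  exists rho : R -> R, [/\ continuous rho, (forall x, `|rho x| <= M) &
   forall (g' t' w' : R -> R) (eg ew : R), is_arc a b eps g' t' -> measurable_fun [set: R] w' ->
     (\int[mu]_(x in `]a, b[) `|g' x - g x|%:E <= eg%:E)%E ->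
     (\int[mu]_(x in `]a, b[) `|w' x - w x|%:E <= ew%:E)%E ->
     (\int[mu]_(x in `]a, b[) (`|w' x / g' x - rho x| * g' x)%:E <=
       (ew + M * eg + e)%:E)%E].
Proof.
move=> A mw wM e0.
have [mg g_ge ig _] := A.
have g0 x : 0 < g x by exact: lt_le_trans (g_ge x).
have M0 : 0 <= M by have := le_trans (normr_ge0 _) (wM a); rewrite pmulr_lge0.
have iw : mu.-integrable `]a, b[ (EFin \o w).
  have H : mu.-integrable `]a, b[ (fun x => (M%:E * (EFin \o g) x)%E) by exact: integrableZl.
  apply: le_integrable H => //; first by apply/measurable_EFinP; exact: measurable_funTS.
  by move=> z _ /=; rewrite lee_fin (le_trans (wM z))// ler_norm.
have ap (u : R -> R) (eta : R) : mu.-integrable `]a, b[ (EFin \o u) -> 0 < eta ->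
    exists2 k : R -> R, continuous k & (\int[mu]_(x in `]a, b[) `|u x - k x|%:E <= eta%:E)%E.
  move=> iu eta0.
  have mufin : (mu `]a, b[%classic < +oo)%E.
    by rewrite /= lebesgue_measure_itv/= lte_fin ab -EFinD ltry.
  have [k_ [ck _ cv]] := approximation_continuous_integrable (measurable_itv _) mufin iu.
  have [n _ Hn] : \forall n \near \oo, (\int[mu]_(x in `]a, b[) `|(u x - k_ n x)%:E| <= eta%:E)%E.
    exact: cvge0_le.
  by exists (k_ n) => //; exact: (Hn n (leqnn n)).
(* The approximation errors enter once through w and 2 M times through g:
   once for the denominator and once for the clamping interval. *)
pose eta := e / (1 + 2 * M).
have eta0 : 0 < eta by rewrite divr_gt0//; lra.
have [w0 cw0 Hw0] := ap _ _ iw eta0; have [k0 ck0 Hk0] := ap _ _ ig eta0.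
(* Since g >= eps, the truncation of k0 does not increase its distance to g. *)
pose K x := Num.max (k0 x) eps.
pose W x := Num.max (- (M * K x)) (Num.min (w0 x) (M * K x)).
have cK : continuous K.
  by move=> x; apply: (@continuous_max R _ k0 (cst eps)); [exact: ck0|exact: cvg_cst].
have cMK : continuous (fun x => M * K x).
  by move=> x; apply: cvgM; [exact: cvg_cst|exact: cK].
have cW : continuous W.
  move=> x; apply: (@continuous_max R _ (fun x => - (M * K x)) (fun x => Num.min (w0 x) (M * K x))).
    by apply: cvgN; exact: cMK.
  by apply: (@continuous_min R _ w0 (fun x => M * K x)); [exact: cw0|exact: cMK].
have K_ge x : eps <= K x by rewrite le_max lexx orbT.
have K0 x : 0 < K x by exact: lt_le_trans (K_ge x).
have WM x : `|W x / K x| <= M.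
  rewrite normrM normfV (gtr0_norm (K0 x)) ler_pdivrMr// ler_norml.
  have MK0 : 0 <= M * K x by rewrite mulr_ge0// ltW.
  by rewrite /W le_max lexx/= ge_max ge_min lexx orbT andbT; lra.
exists (fun x => W x / K x); split => //.
  move=> x; apply: cvgM; first exact: cW.
  by apply: cvgV; [rewrite gt_eqF|exact: cK].
move=> g' t' w' eg ew A' mw' Hg Hw.
have [mg' g'_ge ig' _] := A'.
have g'0 x : 0 < g' x by exact: lt_le_trans (g'_ge x).
have mw0 : measurable_fun [set: R] w0 by exact: continuous_measurable_fun.
have mk0 : measurable_fun [set: R] k0 by exact: continuous_measurable_fun.
have mr : measurable_fun [set: R] (fun x => W x / K x).
  apply: continuous_measurable_fun => x; apply: cvgM; first exact: cW.
  by apply: cvgV; [rewrite gt_eqF|exact: cK].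
have mn (u v : R -> R) : measurable_fun [set: R] u -> measurable_fun [set: R] v ->
    measurable_fun [set: R] (fun x => `|u x - v x|).
  by move=> mu_ mv; apply: measurableT_comp => //; exact: measurable_funB.
have key x : `|w' x / g' x - W x / K x| * g' x <=
    (`|w' x - w x| + `|w x - w0 x|) + M * (`|g' x - g x| + 2 * `|g x - k0 x|).
  apply: le_trans (ratio_close (w' x) (g'0 x) (K0 x) (WM x)) _.
  have KK : `|g x - K x| <= `|g x - k0 x|.
    have := g_ge x; rewrite /K; case: (leP (k0 x) eps) => h h'; last by [].
    by rewrite !ger0_norm; lra.
  have H1 : `|w x - W x| <= `|w x - w0 x| + M * `|g x - K x|.
    rewrite -[X in X * _](ger0_norm M0) -normrM mulrBr; apply: clamp_close => //.
    by rewrite mulr_ge0// ltW.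
  have H2 : `|w' x - W x| <= `|w' x - w x| + `|w x - W x|.
    by rewrite -[_ - _](subrKA (w x)) ler_normD.
  have H3 : `|g' x - K x| <= `|g' x - g x| + `|g x - K x|.
    by rewrite -[_ - _](subrKA (g x)) ler_normD.
  have H4 := ler_wpM2l M0 H3; have H5 := ler_wpM2l M0 KK.
  move: H1 H2 H4 H5; rewrite !mulrDr; move: (M * _) (M * _) (M * _) => p q r.
  lra.
have mG1 : measurable_fun [set: R] (fun x => `|g' x - g x| + 2 * `|g x - k0 x|).
  by apply: measurable_funD; [exact: mn|apply: measurable_funM => //; exact: mn].
have mW1 : measurable_fun [set: R] (fun x => `|w' x - w x| + `|w x - w0 x|).
  by apply: measurable_funD; exact: mn.
have IE (k : R) (u : R -> R) (c : R) : 0 <= k -> measurable_fun [set: R] u -> (forall x, 0 <= u x) ->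
    (\int[mu]_(x in `]a, b[) (u x)%:E <= c%:E)%E ->
    (\int[mu]_(x in `]a, b[) (k * u x)%:E <= (k * c)%:E)%E.
  move=> k00 mu_ u0 H; under eq_integral do rewrite EFinM.
  rewrite ge0_integralZl_EFin//; last by apply/measurable_EFinP; exact: measurable_funTS.
    by rewrite EFinM; apply: lee_wpmul2l => //; rewrite lee_fin.
  by move=> x _; rewrite lee_fin.
have -> : ew + M * eg + e = (ew + eta) + M * (eg + 2 * eta).
  rewrite -[e](@divfK _ (1 + 2 * M)); last by rewrite gt_eqF//; lra.
  rewrite -/eta; lra.
rewrite EFinD.
apply: (@le_trans _ _ (\int[mu]_(x in `]a, b[) (`|w' x - w x| + `|w x - w0 x|)%:E +
  \int[mu]_(x in `]a, b[) (M * (`|g' x - g x| + 2 * `|g x - k0 x|))%:E)%E).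
  apply: le_integral_add => //.
  - apply: measurable_funM => //; apply: mn => //.
    exact: (measurable_div_arc eps0 A' mw').
  - exact: measurable_funM.
  - by move=> x _; rewrite mulr_ge0// ltW.
  - by move=> x _; rewrite mulr_ge0// addr_ge0// mulr_ge0.
apply: leeD.
  rewrite EFinD; apply: le_trans (leeD Hw Hw0).
  by apply: le_integral_add => //; (try exact: mn); move=> x _; rewrite ?addr_ge0.
apply: (IE M) => //.
have m2 : measurable_fun [set: R] (fun x => 2 * `|g x - k0 x|).
  by apply: measurable_funM => //; exact: mn.
rewrite EFinD; apply: (@le_trans _ _ (\int[mu]_(x in `]a, b[) (`|g' x - g x|)%:E +
  \int[mu]_(x in `]a, b[) (2 * `|g x - k0 x|)%:E)%E).
  by apply: le_integral_add => //; (try exact: mn); move=> x _; rewrite ?addr_ge0 ?mulr_ge0.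
by apply: leeD => //; apply: (IE 2) => //; exact: mn.
Qed.

End limit.

(** Denominators carry M + 1 instead of M because M may be 0. *)
Lemma mul_frac_le (R : realFieldType) (M e k : R) : 0 <= M -> 0 < e -> 0 < k ->
  M * (e / (k * (M + 1))) <= e / k.
Proof.
move=> M0 e0 k0; have M1 : 0 < M + 1 by lra.
have -> : M * (e / (k * (M + 1))) = (e / k) * (M / (M + 1)).
  by field; rewrite !gt_eqF.
by rewrite ler_piMr ?divr_ge0 ?(ltW e0) ?(ltW k0)// ler_pdivrMr// mul1r; lra.
Qed.

Section arc_limit.
Context {R : realType}.
Notation mu := (@lebesgue_measure R).
Variables (a b eps : R).
Hypotheses (ab : a < b) (eps0 : 0 < eps).
Variables (g_ t_ : nat -> R -> R) (g t : R -> R).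
Hypotheses (A_ : forall n, is_arc a b eps (g_ n) (t_ n)) (A : is_arc a b eps g t).
Hypothesis g_cvg : forall e, 0 < e -> \forall n \near \oo,
  (\int[mu]_(x in `]a, b[) `|g_ n x - g x|%:E <= e%:E)%E.

Lemma arc_len_cvg (e : R) : 0 < e -> \forall n \near \oo,
  forall x, a <= x <= b -> `|arc_len a (g_ n) x - arc_len a g x| <= e.
Proof.
move=> e0; apply: filterS (g_cvg e0) => n H.
exact: (arc_len_close (A_ n) A H).
Qed.

Lemma arc_inv_cvg (e : R) : 0 < e -> \forall n \near \oo,
  forall y, `|t_ n y - t y| <= e.
Proof.
move=> e0; have := arc_len_cvg (mulr_gt0 e0 eps0).
apply: filterS => n H y; rewrite -[e](mulfK (lt0r_neq0 eps0)).
exact: (arc_inv_close ab eps0 (A_ n) A H).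
Qed.

Variables (w_ G_ : nat -> R -> R) (w G : R -> R) (M : R).
Hypotheses (mw_ : forall n, measurable_fun [set: R] (w_ n)) (mw : measurable_fun [set: R] w).
Hypotheses (wM_ : forall n x, `|w_ n x| <= M * g_ n x) (wM : forall x, `|w x| <= M * g x).
Hypothesis Gw : forall x y, a <= y -> y <= x -> x <= b ->
  G x - G y = \int[mu]_(z in `]y, x[) w z.
Hypothesis w_cvg : forall e, 0 < e -> \forall n \near \oo,
  (\int[mu]_(x in `]a, b[) `|w_ n x - w x|%:E <= e%:E)%E.
Hypothesis G_cvg : forall e, 0 < e -> \forall n \near \oo,
  forall x, a <= x <= b -> `|G_ n x - G x| <= e.

Let M0 : 0 <= M.
Proof.
by have := le_trans (normr_ge0 _) (wM a); rewrite pmulr_lge0//; exact: arc_gt0 eps0 A _.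
Qed.

Lemma primitive_le_arc_len x y : a <= x <= b -> a <= y <= b ->
  `|G x - G y| <= M * `|arc_len a g x - arc_len a g y|.
Proof.
wlog yx : x y / y <= x.
  move=> W hx hy; have [yx|/ltW xy] := leP y x; first exact: W.
  by rewrite distrC [X in M * X]distrC; exact: W.
move=> /andP[ax xb] /andP[ay yb].
have [mg _ ig _] := A.
have ixy : mu.-integrable `]y, x[ (EFin \o g).
  by apply: integrableS ig => //; apply: subset_itv; rewrite bnd_simp.
have iM : mu.-integrable `]y, x[ (EFin \o (fun x => M * g x)).
  by rewrite (_ : _ \o _ = fun x => (M%:E * (EFin \o g) x)%E)//; exact: integrableZl.
have iw : mu.-integrable `]y, x[ (EFin \o w).
  apply: le_integrable iM => //; first by apply/measurable_EFinP; exact: measurable_funTS.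
  by move=> z _ /=; rewrite lee_fin (le_trans (wM z))// ler_norm.
rewrite Gw// (arc_len_diff A)// [X in M * X]ger0_norm; last first.
  by apply: Rintegral_ge0 => z _; exact: ltW (arc_gt0 eps0 A _).
rewrite -RintegralZl//; apply: le_trans (le_normr_Rintegral _ iw) _ => //.
by apply: le_Rintegral => //; exact: integrable_norm iw.
Qed.

(** Since G varies by at most M times the variation of s, it suffices to compare
   s (t_n y) with s (t y); the first is close to s_n (t_n y), and s_n (t_n y) and
   s (t y) are y clamped to [0, L_n] and to [0, L]. *)
Lemma arc_comp_cvg (e : R) : 0 < e -> \forall n \near \oo,
  forall y, `|G_ n (t_ n y) - G (t y)| <= e.
Proof.
move=> e0; have e1 : 0 < e / (4 * (M + 1)).
  by rewrite divr_gt0// mulr_gt0//; move: M0; lra.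
have e2 : 0 < e / 2 by rewrite divr_gt0.
near=> n => y.
have tn := arc_inv_range ab (A_ n) y; have t0 := arc_inv_range ab A y.
have H1 : `|G_ n (t_ n y) - G (t_ n y)| <= e / 2.
  by move: (t_ n y) tn; near: n; exact: G_cvg.
have Hs : forall x, a <= x <= b -> `|arc_len a (g_ n) x - arc_len a g x| <= e / (4 * (M + 1)).
  by near: n; exact: arc_len_cvg.
have H2 : `|arc_len a g (t_ n y) - arc_len a g (t y)| <= e / (2 * (M + 1)).
  have -> : e / (2 * (M + 1)) = e / (4 * (M + 1)) + e / (4 * (M + 1)).
    by field; move: M0 => ?; rewrite gt_eqF//; lra.
  have := Hs _ tn; have := Hs b; rewrite lexx (ltW ab) => /(_ isT).
  rewrite (arc_len_inv ab eps0 (A_ n)) (arc_len_inv ab eps0 A).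
  move: (arc_len a g (t_ n y)) (Num.max y 0) (arc_len a _ b) (arc_len a _ b) (e / _) => p q r s d.
  rewrite !ler_norml => /andP[? ?]; have [?|?] := leP q r; have [?|?] := leP q s;
  by move=> /andP[? ?]; apply/andP; split; lra.
have H3 := le_trans (primitive_le_arc_len tn t0) (ler_wpM2l M0 H2).
have H4 := mul_frac_le M0 e0 (ltr0n R 2).
rewrite -[_ - _](subrKA (G (t_ n y))) (le_trans (ler_normD _ _))//.
by move: H1 H3 H4; move: (`|_|) (`|_|) (M * _) => p q r; lra.
Unshelve. all: by end_near. Qed.

(** The function rho is fixed before n, so that its modulus of uniform continuity
   applies to t_n and t.  Six errors of e / 8 arise: the approximation error once
   for each rate, the errors of w_n and g_n, the variation of rho between t_n and
   t, and the difference of the lengths. *)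
Lemma arc_rate_cvg (e : R) : 0 < e -> \forall n \near \oo,
  (\int[mu]_y `|arc_rate a b (g_ n) (t_ n) (w_ n) y - arc_rate a b g t w y|%:E <= e%:E)%E.
Proof.
move=> e0; have e8 : 0 < e / 8 by rewrite divr_gt0.
have L0 := arc_len_b_gt0 ab eps0 A.
have [rho [crho rhoM Hrho]] := approx_rate ab eps0 A mw wM e8.
set L := arc_len a g b in L0.
have M1 : 0 < M + 1 by move: M0; lra.
have L1 : 0 < L + 1 by lra.
have e31 : 0 < e / (8 * (L + 1)) by rewrite divr_gt0// mulr_gt0.
have eta0 : 0 < e / (16 * (M + 1)) by rewrite divr_gt0// mulr_gt0.
have eg0 : 0 < e / (8 * (M + 1)) by rewrite divr_gt0// mulr_gt0.
have [d d0 Hd] := uniform_continuity_itv a b crho e31.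
have zero (u : R -> R) : (\int[mu]_(x in `]a, b[) `|u x - u x|%:E <= 0%:E)%E.
  by rewrite integral0_eq// => x _; rewrite subrr normr0.
near=> n.
have Hg : (\int[mu]_(x in `]a, b[) `|g_ n x - g x|%:E <= (e / (8 * (M + 1)))%:E)%E.
  by near: n; exact: g_cvg.
have Hw : (\int[mu]_(x in `]a, b[) `|w_ n x - w x|%:E <= (e / 8)%:E)%E.
  by near: n; exact: w_cvg.
have Ht : forall y, `|t_ n y - t y| <= d by near: n; exact: arc_inv_cvg.
have HL : `|arc_len a (g_ n) b - arc_len a g b| <= e / (16 * (M + 1)).
  have : forall x, a <= x <= b -> `|arc_len a (g_ n) x - arc_len a g x| <= e / (16 * (M + 1)).
    by near: n; exact: arc_len_cvg.
  by apply; rewrite lexx ltW.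
have H1 := Hrho _ _ _ _ _ (A_ n) (mw_ n) Hg Hw.
have H2 := Hrho _ _ _ _ _ A mw (zero g) (zero w).
have H3 y : `|rho (t_ n y) - rho (t y)| <= e / (8 * (L + 1)).
  by apply: Hd => //; exact: (arc_inv_range ab (A_ n)).
apply: le_trans (rate_close ab eps0 (A_ n) A (mw_ n) mw (wM_ n) wM crho rhoM
  (ltW e31) (ltW eta0) H1 H2 H3 HL) _.
rewrite lee_fin -/L.
have B1 := mul_frac_le M0 e0 (ltr0n R 8).
have B2 := mul_frac_le (ltW L0) e0 (ltr0n R 8).
have B3 : M * (2 * (e / (16 * (M + 1)))) <= e / 8.
  rewrite (_ : 2 * _ = e / (8 * (M + 1)))//.
  by field; rewrite gt_eqF.
rewrite mulrC in B2.
move: B1 B2 B3; move: (M * _) (_ * L) (M * (2 * _)) => p q r; lra.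
Unshelve. all: by end_near. Qed.

End arc_limit.

(** * Euclidean norms and L^q norms *)

Section enorm.
Context {R : realType} {N : nat}.
Notation mu := (@lebesgue_measure R).
Implicit Types (J : set R) (u : R -> 'rV[R]_N).

Lemma enorm_ge0 (x : 'rV[R]_N) : 0 <= enorm x.
Proof. exact: sqrtr_ge0. Qed.

Lemma sum_sqr_ge0 (x : 'rV[R]_N) : 0 <= \sum_(i < N) x 0 i ^+ 2.
Proof. by apply: sumr_ge0 => i _; exact: sqr_ge0. Qed.

Lemma comp_le_enorm (x : 'rV[R]_N) i : `|x 0 i| <= enorm x.
Proof.
rewrite -sqrtr_sqr ler_sqrt ?sum_sqr_ge0// (bigD1 i)//= lerDl.
by apply: sumr_ge0 => j _; exact: sqr_ge0.
Qed.

(** A triangle inequality whose error is the sum of the components; it follows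
   by expanding the squares of the components of x around those of y. *)
Lemma enorm_le_add_sum (x y : 'rV[R]_N) : enorm x <= enorm y + \sum_(i < N) `|x 0 i - y 0 i|.
Proof.
set D := \sum_(i < N) _; have D0 : 0 <= D by exact: sumr_ge0.
have S0 := enorm_ge0 y.
have DE : 0 <= enorm y + D by exact: addr_ge0.
rewrite -[leRHS](ger0_norm DE) -sqrtr_sqr ler_sqrt ?sqr_ge0//.
have S2 : enorm y ^+ 2 = \sum_(i < N) y 0 i ^+ 2 by rewrite sqr_sqrtr// sum_sqr_ge0.
have dD (i : 'I_N) : `|x 0 i - y 0 i| <= D.
  by rewrite /D (bigD1 i)//= lerDl sumr_ge0.
apply: (@le_trans _ _ (\sum_(i < N) (y 0 i ^+ 2 + (2 * enorm y + D) * `|x 0 i - y 0 i|))).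
  apply: ler_sum => i _; rewrite -[X in X ^+ 2](subrK (y 0 i)).
  set d := x 0 i - y 0 i; have yi := comp_le_enorm y i.
  have H1 : d * y 0 i <= `|d| * enorm y.
    by rewrite (le_trans (ler_norm _))// normrM ler_wpM2l.
  have H2 : d ^+ 2 <= D * `|d|.
    by rewrite -real_normK ?num_real// expr2 ler_wpM2r// dD.
  have -> : (d + y 0 i) ^+ 2 = d ^+ 2 + 2 * (d * y 0 i) + y 0 i ^+ 2 by ring.
  have -> : y 0 i ^+ 2 + (2 * enorm y + D) * `|d| =
    y 0 i ^+ 2 + 2 * (`|d| * enorm y) + D * `|d| by ring.
  move: H1 H2.
  move: (`|d| * enorm y) (d * y 0 i) (d ^+ 2) (D * `|d|) (y 0 i ^+ 2) => p q r s z; lra.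
rewrite big_split/= -S2 -mulr_sumr -/D.
by rewrite le_eqVlt; apply/orP; left; apply/eqP; ring.
Qed.

Lemma enorm_diff_le (x y : 'rV[R]_N) : `|enorm x - enorm y| <= \sum_(i < N) `|x 0 i - y 0 i|.
Proof.
have H1 := enorm_le_add_sum x y; have := enorm_le_add_sum y x.
under eq_bigr do rewrite distrC.
by rewrite ler_norml => H2; apply/andP; split; lra.
Qed.

Lemma enorm0 : enorm (0 : 'rV[R]_N) = 0.
Proof. by rewrite /enorm big1 ?sqrtr0// => i _; rewrite mxE expr0n. Qed.

Lemma enorm_le_sum (x : 'rV[R]_N) : enorm x <= \sum_(i < N) `|x 0 i|.
Proof.
apply: le_trans (enorm_le_add_sum x 0) _; rewrite enorm0 add0r.
by apply: ler_sum => i _; rewrite mxE subr0.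
Qed.

Lemma measurable_enorm J u : (forall i, measurable_fun J (fun z => u z 0 i)) ->
  measurable_fun J (fun z => enorm (u z)).
Proof.
move=> mu_; apply: measurableT_comp.
  by apply: continuous_measurable_fun; exact: sqrt_continuous.
by apply: measurable_sum => i; apply: measurable_funX.
Qed.

Lemma Lq_normE J (q : R) u : q != 0 ->
  Lq_norm J q u = ((\int[mu]_(x in J) (enorm (u x) `^ q)%:E) `^ q^-1)%E.
Proof.
move=> q0; rewrite /Lq_norm unlock; congr (_ `^ _)%E.
rewrite [RHS]integral_mkcond; apply: eq_integral => x _.
rewrite !patchE; case: ifP => _; first by rewrite /= ger0_norm ?enorm_ge0.
by rewrite abse0 poweR0r.
Qed.

Lemma Lq_norm_le J (q e : R) u : 1 <= q -> 0 <= e ->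
  (\int[mu]_(x in J) (enorm (u x) `^ q)%:E <= (e `^ q)%:E)%E -> (Lq_norm J q u <= e%:E)%E.
Proof.
move=> q1 e0 H; have q0 : q != 0 by rewrite gt_eqF//; lra.
rewrite Lq_normE//.
have -> : e%:E = ((e `^ q)%:E `^ q^-1)%E.
  by rewrite poweR_EFin -powRrM mulfV// powRr1.
apply: gt0_ler_poweR => //.
- by rewrite invr_ge0; lra.
- by rewrite in_itv/= leey andbT; apply: integral_ge0 => x _; rewrite lee_fin powR_ge0.
- by rewrite in_itv/= leey andbT lee_fin powR_ge0.
Qed.

Lemma Lq_norm_integral J (q e : R) u : 1 <= q -> 0 <= e ->
  (Lq_norm J q u <= e%:E)%E -> (\int[mu]_(x in J) (enorm (u x) `^ q)%:E <= (e `^ q)%:E)%E.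
Proof.
move=> q1 e0 H; have q0 : q != 0 by rewrite gt_eqF//; lra.
have I0 : (0 <= \int[mu]_(x in J) (enorm (u x) `^ q)%:E)%E.
  by apply: integral_ge0 => x _; rewrite lee_fin powR_ge0.
have -> : (\int[mu]_(x in J) (enorm (u x) `^ q)%:E = (Lq_norm J q u `^ q)%E)%E.
  by rewrite Lq_normE// -poweRrM mulVf// poweRe1.
rewrite -poweR_EFin; apply: gt0_ler_poweR => //.
- by lra.
- by rewrite in_itv/= leey andbT Lnorm_ge0.
- by rewrite in_itv/= leey andbT lee_fin.
Qed.

(** A substitute for the inequality of Hoelder: x <= delta + delta^(1-p) x^p for
   x >= 0, integrated over J. *)
Lemma Lq_to_L1 J (p delta l : R) u : measurable J -> (mu J <= l%:E)%E -> 1 <= p -> 0 < delta ->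
  (forall i, measurable_fun J (fun z => u z 0 i)) ->
  (Lq_norm J p u <= delta%:E)%E ->
  (\int[mu]_(x in J) (enorm (u x))%:E <= (delta * (l + 1))%:E)%E.
Proof.
move=> mJ Jl p1 d0 mu_ /(Lq_norm_integral p1 (ltW d0)) H.
have me := measurable_enorm mu_.
pose k := (delta `^ (p - 1))^-1.
have dp0 : 0 < delta `^ (p - 1) by rewrite powR_gt0.
have k0 : 0 <= k by rewrite invr_ge0 ltW.
have kd : k * delta `^ p = delta.
  by rewrite -(@mulr_powRB1 _ delta p) ?(ltW d0)//; [rewrite /k mulrCA mulVf ?mulr1// gt_eqF|lra].
have key (x : R) : enorm (u x) <= delta + k * enorm (u x) `^ p.
  have e0 := enorm_ge0 (u x).
  have [xd|dx] := leP (enorm (u x)) delta.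
    by rewrite (le_trans xd)// lerDl mulr_ge0// powR_ge0.
  apply: (@le_trans _ _ (k * enorm (u x) `^ p)); last by rewrite lerDr ltW.
  rewrite mulrC ler_pdivlMr// -(@mulr_powRB1 _ (enorm (u x)) p)//; last lra.
  rewrite ler_wpM2l//; apply: ge0_ler_powR; rewrite ?nnegrE ?(ltW d0)// ?(ltW dx)//; lra.
have mp : measurable_fun J (EFin \o (fun x => enorm (u x) `^ p)).
  by apply/measurable_EFinP; exact: (measurableT_comp (measurable_powR p) me).
apply: (@le_trans _ _ (\int[mu]_(x in J) (delta%:E + k%:E * (enorm (u x) `^ p)%:E))%E).
  apply: ge0_le_integral => //.
  - by move=> x _; rewrite lee_fin enorm_ge0.
  - exact/measurable_EFinP.
  - by apply: emeasurable_funD => //; apply: emeasurable_funM.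
  - by move=> x _; rewrite -EFinM -EFinD lee_fin.
rewrite ge0_integralD//; last 3 first.
- by move=> x _; rewrite lee_fin ltW.
- by move=> x _; rewrite -EFinM lee_fin mulr_ge0// powR_ge0.
- exact: emeasurable_funM.
rewrite mulrDr mulr1 EFinD integral_cst// ge0_integralZl_EFin//; last first.
  by move=> x _; rewrite lee_fin powR_ge0.
apply: leeD; first by rewrite EFinM; apply: lee_wpmul2l => //; rewrite lee_fin ltW.
by rewrite -[in leRHS]kd EFinM; apply: lee_wpmul2l => //; rewrite lee_fin.
Qed.

(** For functions bounded by C, x^q <= C^(q-1) x. *)
Lemma L1_to_Lq J (q C e eta : R) u : measurable J -> 1 <= q -> 0 <= e ->
  (forall i, measurable_fun J (fun z => u z 0 i)) ->
  (forall x, J x -> enorm (u x) <= C) ->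
  (\int[mu]_(x in J) (enorm (u x))%:E <= eta%:E)%E -> C `^ (q - 1) * eta <= e `^ q ->
  (Lq_norm J q u <= e%:E)%E.
Proof.
move=> mJ q1 e0 mu_ uC H He; apply: Lq_norm_le => //.
have me := measurable_enorm mu_.
have C0 : 0 <= C `^ (q - 1) by exact: powR_ge0.
apply: (@le_trans _ _ (\int[mu]_(x in J) ((C `^ (q - 1))%:E * (enorm (u x))%:E))%E).
  apply: ge0_le_integral => //.
  - by move=> x _; rewrite lee_fin powR_ge0.
  - by apply/measurable_EFinP; exact: (measurableT_comp (measurable_powR q) me).
  - by apply: emeasurable_funM => //; exact/measurable_EFinP.
  - move=> x Jx; rewrite -EFinM lee_fin -(@mulr_powRB1 _ (enorm (u x)) q) ?enorm_ge0//; last lra.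
    rewrite mulrC ler_wpM2r ?enorm_ge0//; apply: ge0_ler_powR; rewrite ?nnegrE ?enorm_ge0 ?uC//; first lra.
    exact: le_trans (enorm_ge0 _) (uC _ Jx).
rewrite ge0_integralZl_EFin//; last 2 first.
- by move=> x _; rewrite lee_fin enorm_ge0.
- exact/measurable_EFinP.
apply: (@le_trans _ _ ((C `^ (q - 1))%:E * eta%:E)%E); last by rewrite -EFinM lee_fin.
by apply: lee_wpmul2l => //; rewrite lee_fin.
Qed.

Lemma integral_enorm_le J (eta : R) u : measurable J ->
  (forall i, measurable_fun J (fun z => u z 0 i)) ->
  (forall i, (\int[mu]_(x in J) `|u x 0 i|%:E <= eta%:E)%E) ->
  (\int[mu]_(x in J) (enorm (u x))%:E <= (N%:R * eta)%:E)%E.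
Proof.
move=> mJ mu_ H; have me := measurable_enorm mu_.
have mi i : measurable_fun J (fun x => `|u x 0 i|%:E).
  by apply/measurable_EFinP; apply: measurableT_comp.
apply: (@le_trans _ _ (\int[mu]_(x in J) (\sum_(i < N) `|u x 0 i|%:E))%E).
  apply: ge0_le_integral => //.
  - by move=> x _; rewrite lee_fin enorm_ge0.
  - exact/measurable_EFinP.
  - by apply: emeasurable_sum => i; exact: mi.
  - by move=> x _; rewrite sumEFin lee_fin enorm_le_sum.
rewrite ge0_integral_sum//; apply: (@le_trans _ _ (\sum_(i < N) eta%:E)%E).
  by apply: lee_sum => i _.
by rewrite sumEFin sumr_const card_ord mulr_natl.
Qed.

End enorm.

(** * Sobolev convergence of functions with bounded rates *)

Section sobolev.
Context {R : realType} {N : nat}.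
Notation mu := (@lebesgue_measure R).
Implicit Types (c d : R) (u v r : R -> 'rV[R]_N).

Lemma weak_derivP (J : set R) u v : is_weak_deriv J u v -> is_weak_deriv J u (weak_deriv J u).
Proof. by move=> H; apply: (@xgetPex _ (cst 0) (is_weak_deriv J u)); exists v. Qed.

(** The chosen weak derivative and v have the same integrals over all compact
   subintervals, namely the increments of u. *)
Lemma weak_deriv_unique c d u v :
  (forall i, {in `]c, d[, continuous (fun x => u x 0 i)}) ->
  is_weak_deriv `]c, d[ u v ->
  {ae mu, forall x, x \in `]c, d[ -> weak_deriv `]c, d[ u x = v x}.
Proof.
move=> cu uv; have uw := weak_derivP uv.
have H i : {ae mu, forall x, x \in `]c, d[ -> weak_deriv `]c, d[ u x 0 i = v x 0 i}.
  apply: ae_eq_of_primitives; [by case: (uw i)|by case: (uv i)|].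
  move=> x y cy yx xd; rewrite -(primitive_of_weak (cu i) (uv i))//.
  by rewrite -(primitive_of_weak (cu i) (uw i)).
have := @filter_forall _ _ _ _ (ae_filter_ringOfSetsType mu) H.
apply: (@filterS _ _ (ae_filter_ringOfSetsType mu)) => x Hx xcd.
by apply/rowP => i; exact: Hx.
Qed.

Lemma eq_ae_Lq_norm (J : set R) (q : R) u v : measurable J -> q != 0 ->
  (forall i, measurable_fun J (fun z => u z 0 i)) ->
  (forall i, measurable_fun J (fun z => v z 0 i)) ->
  {ae mu, forall x, J x -> u x = v x} -> Lq_norm J q u = Lq_norm J q v.
Proof.
move=> mJ q0 mu_ mv uv; rewrite (Lq_normE _ u q0) (Lq_normE _ v q0); apply: (congr1 (fun z : \bar R => z `^ q^-1)%E).
have mp (w : R -> 'rV[R]_N) : (forall i, measurable_fun J (fun z => w z 0 i)) ->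
    measurable_fun J (EFin \o (fun x : R => enorm (w x : 'rV[R]_N) `^ q)).
  move=> mw; apply/measurable_EFinP.
  exact: (measurableT_comp (measurable_powR q) (measurable_enorm mw)).
apply: ge0_ae_eq_integral => //; [exact: mp|exact: mp| | |].
- by move=> x _; rewrite lee_fin powR_ge0.
- by move=> x _; rewrite lee_fin powR_ge0.
- apply: (@filterS _ _ (ae_filter_ringOfSetsType mu)) uv => x + Jx.
  by move=> /(_ Jx) ->.
Qed.

Lemma Lq_norm_lty (J : set R) (q C l : R) u : measurable J -> (mu J <= l%:E)%E -> 1 <= q ->
  (forall i, measurable_fun J (fun z => u z 0 i)) ->
  (forall x, J x -> forall i, `|u x 0 i| <= C) -> (Lq_norm J q u < +oo)%E.
Proof.
move=> mJ Jl q1 mu_ uC; rewrite Lq_normE; last by rewrite gt_eqF//; lra.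
apply: poweR_lty.
have me := measurable_enorm mu_.
have eC x : J x -> enorm (u x) <= N%:R * C.
  move=> Jx; apply: le_trans (enorm_le_sum _) _.
  apply: (@le_trans _ _ (\sum_(i < N) C)); first by apply: ler_sum => i _; exact: uC.
  by rewrite sumr_const card_ord mulr_natl.
apply: (@le_lt_trans _ _ (\int[mu]_(x in J) (cst ((N%:R * C) `^ q)%:E x))%E).
  apply: ge0_le_integral => //.
  - by move=> x _; rewrite lee_fin powR_ge0.
  - by apply/measurable_EFinP; exact: (measurableT_comp (measurable_powR q) me).
  - move=> x Jx; rewrite lee_fin; apply: ge0_ler_powR; rewrite ?nnegrE ?enorm_ge0 ?eC//; first lra.
    exact: le_trans (enorm_ge0 _) (eC _ Jx).
rewrite integral_cst//; apply: (@le_lt_trans _ _ (((N%:R * C) `^ q)%:E * l%:E)%E); last by rewrite -EFinM ltry.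
by apply: lee_wpmul2l => //; rewrite lee_fin powR_ge0.
Qed.

(** The function u is, on the whole line, a primitive of the bounded function r:
   the form taken by t and F o t. *)
Definition bounded_rate (B : R) u r : Prop :=
  [/\ (forall i, measurable_fun [set: R] (fun x => r x 0 i)),
      (forall i x, `|r x 0 i| <= B) &
      (forall i x y, y <= x -> u x 0 i - u y 0 i = \int[mu]_(z in `]y, x[) r z 0 i)].

Lemma bounded_rate_integrable B u r i x y : bounded_rate B u r ->
  mu.-integrable `]x, y[ (EFin \o (fun z => r z 0 i)).
Proof.
move=> [mr rB _].
rewrite (_ : (fun z => r z 0 i) = (fun z => r z 0 i * cst 1 z)); last first.
  by apply/funext => z; rewrite mulr1.
apply: (integrable_bounded_mul (M := B)) => //.
- exact: measurable_funTS.
- exact: integrable_cst_oo.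
Qed.

Lemma bounded_rateB B B' u r u' r' : bounded_rate B u r -> bounded_rate B' u' r' ->
  bounded_rate (B + B') (fun x => u x - u' x) (fun x => r x - r' x).
Proof.
move=> H H'; have [mr rB ur] := H; have [mr' rB' ur'] := H'; split.
- move=> i; have := measurable_funB (mr i) (mr' i).
  by apply: eq_measurable_fun => x _ /=; rewrite !mxE.
- by move=> i x; rewrite !mxE (le_trans (ler_normB _ _))// lerD.
- move=> i x y yx.
  have -> : (u x - u' x) 0 i - (u y - u' y) 0 i =
      (u x 0 i - u y 0 i) - (u' x 0 i - u' y 0 i) by rewrite !mxE; ring.
  rewrite ur// ur'//.
  rewrite -RintegralB//; [|exact: bounded_rate_integrable H|exact: bounded_rate_integrable H'].
  by apply: eq_Rintegral => z _; rewrite !mxE.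
Qed.

Lemma bounded_rate_continuous B u r i : bounded_rate B u r ->
  continuous (fun x => u x 0 i).
Proof.
move=> H; have [mr rB ur] := H.
have B0 : 0 <= B by exact: le_trans (rB i 0).
have lip x y : y <= x -> `|u x 0 i - u y 0 i| <= B * (x - y).
  move=> yx; rewrite ur//.
  have ir := bounded_rate_integrable i y x H.
  apply: le_trans (le_normr_Rintegral _ ir) _ => //.
  apply: (@le_trans _ _ (\int[mu]_(z in `]y, x[) B)).
    apply: le_Rintegral => //; [exact: integrable_norm ir|exact: integrable_cst_oo].
  rewrite Rintegral_cst//= lebesgue_measure_itv/= lte_fin.
  by move: yx; rewrite le_eqVlt => /predU1P[->|->//]; rewrite ltxx subrr.
move=> x; apply/cvgrPdist_le => e e0; near=> y.
apply: (@le_trans _ _ ((B + 1) * `|x - y|)).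
  have [yx|/ltW xy] := leP y x.
    by rewrite (le_trans (lip _ _ yx))// ger0_norm ?subr_ge0// ler_wpM2r ?subr_ge0//; lra.
  rewrite distrC [X in _ * X]distrC.
  by rewrite (le_trans (lip _ _ xy))// ger0_norm ?subr_ge0// ler_wpM2r ?subr_ge0//; lra.
rewrite mulrC -ler_pdivlMr; last lra.
by near: y; apply: cvgr_dist_le => //; apply: divr_gt0 => //; lra.
Unshelve. all: by end_near. Qed.

Lemma bounded_rate_weak_deriv B u r c d : c < d -> bounded_rate B u r ->
  is_weak_deriv `]c, d[ u r.
Proof.
move=> cd H i; have [mr rB ur] := H.
apply: (weak_of_primitive cd); first exact: bounded_rate_integrable H.
by move=> x y _ yx _; exact: ur.
Qed.

Lemma bounded_rate_weak_derivE B u r c d (q : R) : c < d -> q != 0 -> bounded_rate B u r ->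
  Lq_norm `]c, d[ q (weak_deriv `]c, d[ u) = Lq_norm `]c, d[ q r.
Proof.
move=> cd q0 H; have W := bounded_rate_weak_deriv cd H.
have W' := weak_derivP W.
apply: eq_ae_Lq_norm => //.
- by move=> i; have [[]] := W' i.
- by move=> i; have [mr _ _] := H; exact: measurable_funTS.
- apply: (weak_deriv_unique _ W) => i x _; exact: bounded_rate_continuous H x.
Qed.

Lemma bounded_rate_W1q B u r c d (q : R) : c < d -> 1 <= q -> bounded_rate B u r ->
  in_W1q `]c, d[ q u.
Proof.
move=> cd q1 H; have [mr rB _] := H.
have mcd : (mu `]c, d[%classic <= (d - c)%:E)%E.
  by rewrite /= lebesgue_measure_itv/= lte_fin cd -EFinD.
have mr' i : measurable_fun `]c, d[ (fun z => r z 0 i) by exact: measurable_funTS.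
have mu' i : measurable_fun `]c, d[ (fun z => u z 0 i).
  by apply: measurable_funTS; apply: continuous_measurable_fun; exact: bounded_rate_continuous H.
have bu i : exists M, forall x, x \in `[c, d] -> `|u x 0 i| <= M.
  by apply: continuous_bounded_itv; apply: continuous_subspaceT; exact: bounded_rate_continuous H.
split.
  split => //.
  pose M i := projT1 (cid (bu i)).
  apply: (@Lq_norm_lty _ _ (\sum_i `|M i|) (d - c)) => // x xcd i.
  have := projT2 (cid (bu i)) x (subset_itv_oo_cc xcd) => /le_trans; apply.
  rewrite (le_trans (ler_norm _))// -/(M i) (bigD1 i)//= lerDl.
  exact: sumr_ge0.
exists r; first exact: bounded_rate_weak_deriv H.
by split => //; apply: (@Lq_norm_lty _ _ B (d - c)).
Qed.

(** On a bounded interval, both u_n - u and its weak derivative r_n - r are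
   uniformly bounded and tend to 0 in L^1, hence in every L^q. *)
Lemma W1q_loc_cvg_bounded_rate (B q : R) (u_ r_ : nat -> R -> 'rV[R]_N) u r : 1 <= q ->
  (forall n, bounded_rate B (u_ n) (r_ n)) -> bounded_rate B u r ->
  (forall i e, 0 < e -> \forall n \near \oo, forall y, `|u_ n y 0 i - u y 0 i| <= e) ->
  (forall i e, 0 < e -> \forall n \near \oo,
     (\int[mu]_y `|r_ n y 0 i - r y 0 i|%:E <= e%:E)%E) ->
  W1q_loc_cvg q u_ u.
Proof.
move=> q1 H_ H Hu Hr c d cd.
split; [by move=> n; exact: bounded_rate_W1q (H_ n)|exact: bounded_rate_W1q H|].
have q0 : q != 0 by rewrite gt_eqF//; lra.
have HB n := bounded_rateB (H_ n) H.
pose J := `]c, d[%classic.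
have mJ : measurable (J : set R) by exact: measurable_itv.
have cvgLq (w_ : nat -> R -> 'rV[R]_N) (C : R) : 0 < C ->
    (forall n i, measurable_fun J (fun z => w_ n z 0 i)) ->
    (\forall n \near \oo, forall x, J x -> forall i, `|w_ n x 0 i| <= C) ->
    (forall i e, 0 < e -> \forall n \near \oo,
       (\int[mu]_(x in J) `|w_ n x 0 i|%:E <= e%:E)%E) ->
    forall e, 0 < e -> \forall n \near \oo, (Lq_norm J q (w_ n) <= e%:E)%E.
  move=> C0 mw wC wL e e0.
  (* A bound of the Euclidean norm, made positive even when N = 0. *)
  pose C' := (N%:R + 1) * C; have C'0 : 0 < C' by rewrite mulr_gt0// ltr_pwDr.
  have Cq : 0 < C' `^ (q - 1) by rewrite powR_gt0.
  pose eta := e `^ q / (C' `^ (q - 1) * (N%:R + 1)).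
  have eta0 : 0 < eta by rewrite divr_gt0 ?powR_gt0// mulr_gt0// ltr_pwDr.
  have wL' : \forall n \near \oo, forall i,
      (\int[mu]_(x in J) `|w_ n x 0 i|%:E <= eta%:E)%E.
    by apply: filter_forall => i; exact: wL.
  near=> n.
  apply: (@L1_to_Lq _ _ J q C' e (N%:R * eta)) => //.
  - exact: ltW.
  - move=> x Jx; apply: le_trans (enorm_le_sum _) _.
    apply: (@le_trans _ _ (\sum_(i < N) C)).
      apply: ler_sum => i _; move: x Jx i.
      by near: n.
    by rewrite sumr_const card_ord -mulr_natl ler_wpM2r ?(ltW C0)// lerDl.
  - by apply: integral_enorm_le => //; near: n.
  - have -> : C' `^ (q - 1) * (N%:R * eta) = N%:R * (e `^ q / (1 * (N%:R + 1))).
      rewrite /eta; field; rewrite gt_eqF//=.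
      by rewrite gt_eqF// ltr_pwDr.
    by have := @mul_frac_le R N%:R (e `^ q) 1 (ler0n _ _) (powR_gt0 _ e0) ltr01; rewrite divr1.
have cvg1 (e : R) : 0 < e -> \forall n \near \oo, (Lq_norm J q (fun x => u_ n x - u x)%R <= e%:E)%E.
  apply: (cvgLq _ 1) => //.
  - move=> n i; apply: measurable_funTS; apply: continuous_measurable_fun.
    exact: bounded_rate_continuous (HB n).
  - have : \forall n \near \oo, forall i, forall y, `|u_ n y 0 i - u y 0 i| <= 1.
      by apply: filter_forall => i; exact: Hu.
    by apply: filterS => n Hn x _ i; rewrite !mxE.
  - move=> i e' e'0; have dc0 : 0 < d - c by rewrite subr_gt0.
    apply: filterS (Hu i _ (divr_gt0 e'0 dc0)) => n Hn.
    apply: (@le_trans _ _ (\int[mu]_(x in J) (cst (e' / (d - c))%:E x))%E).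
      apply: ge0_le_integral => //.
      + apply/measurable_EFinP; apply: measurableT_comp => //.
        apply: measurable_funTS; apply: continuous_measurable_fun.
        exact: bounded_rate_continuous (HB n).
      + by move=> x _; rewrite lee_fin !mxE.
    rewrite integral_cst//= /J lebesgue_measure_itv/= lte_fin cd -EFinD -EFinM.
    by rewrite divfK// gt_eqF.
have cvg2 (e : R) : 0 < e -> \forall n \near \oo, (Lq_norm J q (fun x => r_ n x - r x)%R <= e%:E)%E.
  have mHB n i : measurable_fun J (fun z => (r_ n z - r z) 0 i).
    by have [mr _ _] := HB n; exact: measurable_funTS.
  apply: (cvgLq _ (`|B + B| + 1)) => //.
  - near=> n => x _ i; have [_ rB _] := HB n.
    by rewrite (le_trans (rB i x))// (le_trans (ler_norm _))// lerDl.
  - move=> i e' e'0; apply: filterS (Hr i _ e'0) => n; apply: le_trans.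
    rewrite (_ : (fun x => `|(r_ n x - r x) 0 i|%:E) = (fun x => `|r_ n x 0 i - r x 0 i|%:E)); last first.
      by apply/funext => x; rewrite !mxE.
    apply: ge0_subset_integral => //.
    apply/measurable_EFinP; apply: measurableT_comp => //.
    have [mr _ _] := HB n; have := mr i; apply: eq_measurable_fun => x _.
    by rewrite !mxE.
apply: le_cvge0.
  by move=> n; apply: adde_ge0; exact: Lnorm_ge0.
move=> e e0; have e20 : 0 < e / 2 by rewrite divr_gt0.
near=> n; rewrite /W1q_norm (bounded_rate_weak_derivE cd q0 (HB n)).
rewrite [e]splitr EFinD; apply: leeD; near: n; [exact: cvg1|exact: cvg2].
Unshelve. all: by end_near. Qed.

End sobolev.

(** * The arc length of a Sobolev curve *)

Section curve.
Context {R : realType} {N : nat}.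
Notation mu := (@lebesgue_measure R).
Variables (a b : R).
Hypothesis ab : a < b.
Notation J := `]a, b[%classic.

Lemma constant_endpoints (D : R -> R) : {within `[a, b], continuous D} ->
  {in `]a, b[ &, forall x y, D x = D y} -> {in `[a, b] &, forall x y, D x = D y}.
Proof.
move=> /(continuous_within_itvP _ ab)[_ Da Db] DC.
pose m := (a + b) / 2.
have mab : m \in `]a, b[.
  by rewrite in_itv/= /m; move: ab => ab'; apply/andP; split; lra.
have Ea : D a = D m.
  apply: (@cvg_unique _ _ (D x @[x --> a^'+])) => //.
  apply: cvg_near_cst; near=> x; apply: DC => //.
  by rewrite in_itv/=; apply/andP; split; near: x; [exact: nbhs_right_gt|exact: nbhs_right_lt].
have Eb : D b = D m.
  apply: (@cvg_unique _ _ (D x @[x --> b^'-])) => //.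
  apply: cvg_near_cst; near=> x; apply: DC => //.
  by rewrite in_itv/=; apply/andP; split; near: x; [exact: nbhs_left_gt|exact: nbhs_left_lt].
have W x : x \in `[a, b] -> D x = D m.
  rewrite in_itv/= => /andP[]; rewrite le_eqVlt => /predU1P[<- //|ax].
  rewrite le_eqVlt => /predU1P[-> //|xb].
  by apply: DC => //; rewrite in_itv/= ax.
by move=> x y xab yab; rewrite !W.
Unshelve. all: by end_near. Qed.

(** Extension of the weak derivative by 0, which makes it Borel on the whole
   line. *)
Definition velocity (F : R -> 'rV[R]_N) (x : R) : 'rV[R]_N :=
  \row_i ((fun y => weak_deriv J F y 0 i) \_ J) x.

Section one_curve.
Variables (p : R) (F : R -> 'rV[R]_N).
Hypotheses (p1 : 1 <= p) (cF : forall i, {within `[a, b], continuous (fun x => F x 0 i)}).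
Hypothesis WF : in_W1q J p F.
Notation v := (weak_deriv J F).

Let weakF i : weak_derivative J (fun x => F x 0 i) (fun x => v x 0 i).
Proof. by case: WF => _ [v' Wv' _]; exact: weak_derivP Wv' i. Qed.

Let cFoo i : {in `]a, b[, continuous (fun x => F x 0 i)}.
Proof. by move=> x xab; exact: (within_continuous_continuous ab (@cF i) xab). Qed.

Let muJ : mu J = (b - a)%:E.
Proof. by rewrite /= lebesgue_measure_itv/= lte_fin ab -EFinD. Qed.

(** The chosen weak derivative coincides almost everywhere with one that belongs
   to L^p, hence to L^1 on a bounded interval. *)
Lemma weak_deriv_integrable i : mu.-integrable J (EFin \o (fun x => v x 0 i)).
Proof.
case: WF => _ [v' Wv' [mv' Lv']].
have [[mv _ _] _] := weakF i.
apply/integrableP; split; first exact/measurable_EFinP.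
have ae : {ae mu, forall x, J x -> v x = v' x}.
  by apply: (weak_deriv_unique _ Wv') => j; exact: cFoo.
rewrite (@ge0_ae_eq_integral _ _ _ mu J _ (fun x => `|v' x 0 i|%:E))//.
- pose delta := fine (Lq_norm J p v') + 1.
  have L0 : (0 <= Lq_norm J p v')%E by exact: Lnorm_ge0.
  have d0 : 0 < delta by rewrite ltr_wpDl// fine_ge0.
  have Hd : (Lq_norm J p v' <= delta%:E)%E.
    by rewrite /delta EFinD fineK ?leeDl// ge0_fin_numE.
  have muJ' : (mu J <= (b - a)%:E)%E by rewrite muJ.
  have := Lq_to_L1 (measurable_itv _) muJ' p1 d0 mv' Hd.
  move=> H; apply: le_lt_trans (le_lt_trans H (ltry _)).
  apply: ge0_le_integral => //.
  + by apply/measurable_EFinP; apply: measurableT_comp => //; exact: mv'.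
  + by apply/measurable_EFinP; exact: measurable_enorm.
  + by move=> x _; rewrite lee_fin comp_le_enorm.
- by apply/measurable_EFinP; apply: measurableT_comp.
- by apply/measurable_EFinP; apply: measurableT_comp => //; exact: mv'.
- apply: (@filterS _ _ (ae_filter_ringOfSetsType mu)) ae => x + Jx.
  by move=> /(_ Jx) /= ->.
Qed.

Lemma velocity_in x : J x -> velocity F x = v x.
Proof. by move=> Jx; apply/rowP => i; rewrite mxE patchE mem_set. Qed.

Lemma measurable_velocity i : measurable_fun [set: R] (fun x => velocity F x 0 i).
Proof.
have [[mv _ _] _] := weakF i.
rewrite (_ : (fun x => _) = (fun y => v y 0 i) \_ J); last first.
  by apply/funext => x; rewrite mxE.
by apply/(measurable_restrictT _ _).1.
Qed.

Lemma velocity_integrable i : mu.-integrable J (EFin \o (fun x => velocity F x 0 i)).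
Proof.
have := weak_deriv_integrable i; apply: eq_integrable => // x; rewrite inE => Jx.
by rewrite /= velocity_in.
Qed.

(** The increments agree inside ]a, b[, and both sides are continuous up to the
   endpoints. *)
Lemma velocity_primitive i x y : a <= y -> y <= x -> x <= b ->
  F x 0 i - F y 0 i = \int[mu]_(z in `]y, x[) velocity F z 0 i.
Proof.
move=> ay yx xb.
pose V x := \int[mu]_(z in `]a, x[) velocity F z 0 i.
have cV : {within `[a, b], continuous V}.
  by apply: continuous_primitive; [exact: ltW|exact: velocity_integrable].
have VE s t : a <= t -> t <= s -> s <= b -> V s - V t = \int[mu]_(z in `]t, s[) velocity F z 0 i.
  move=> at_ ts sb; rewrite /V (@Rintegral_oo_split R a t s)//; first by rewrite addrC addKr.
  by apply: integrableS (velocity_integrable i) => //; apply: subset_itvl; rewrite bnd_simp.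
pose D z := F z 0 i - V z.
have cD : {within `[a, b], continuous D}.
  by move=> z; apply: cvgB; [exact: (@cF i)|exact: cV].
have DC : {in `]a, b[ &, forall s t, D s = D t}.
  have W s t : s \in `]a, b[ -> t \in `]a, b[ -> t <= s -> D s = D t.
    rewrite !in_itv/= => /andP[as_ sb] /andP[at_ tb] ts.
    have := primitive_of_weak (@cFoo i) (weakF i) at_ ts sb.
    have -> : \int[mu]_(z in `]t, s[) v z 0 i = \int[mu]_(z in `]t, s[) velocity F z 0 i.
      apply: eq_Rintegral => z; rewrite mem_oo => /andP[tz zs].
      by rewrite velocity_in//= in_itv/= (lt_trans at_ tz) (lt_trans zs sb).
    rewrite -(VE s t (ltW at_) ts (ltW sb)) /D.
    by move: (F s 0 i) (F t 0 i) (V s) (V t) => p1' p2 p3 p4; lra.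
  move=> s t sab tab; have [ts|/ltW st] := leP t s; first exact: W.
  by apply/esym; exact: W.
have DCC : {in `[a, b] &, forall s t, D s = D t}.
  exact: constant_endpoints.
have xab : x \in `[a, b] by rewrite in_itv/= xb andbT (le_trans ay).
have yab : y \in `[a, b] by rewrite in_itv/= ay (le_trans yx).
have := DCC x y xab yab; rewrite -(VE x y ay yx xb) /D.
by move: (F x 0 i) (F y 0 i) (V x) (V y) => p1' p2 p3 p4; lra.
Qed.

Variable (eps : R).
Hypothesis eps0 : 0 < eps.

Definition speed (x : R) : R := eps + enorm (velocity F x).

Lemma arc_s_speed x : x <= b -> arc_s a b eps F x = arc_len a speed x.
Proof.
move=> xb; apply: eq_Rintegral => z; rewrite mem_oo => /andP[az zx].
by rewrite /speed velocity_in//= in_itv/= az (lt_le_trans zx xb).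
Qed.

Lemma measurable_speed : measurable_fun [set: R] speed.
Proof.
by apply: measurable_funD => //; apply: measurable_enorm; exact: measurable_velocity.
Qed.

Lemma integrable_speed : mu.-integrable J (EFin \o speed).
Proof.
pose h (i : 'I_N) (x : R) : R := `|velocity F x 0 i|.
have isum : mu.-integrable J (fun x => (\sum_(i < N) (EFin \o h i) x)%E).
  by apply: integrable_sum => // i _; exact: integrable_norm (velocity_integrable i).
have H : mu.-integrable J (fun x => ((EFin \o cst eps) x + \sum_(i < N) (EFin \o h i) x)%E).
  by apply: integrableD => //; exact: integrable_cst_oo.
apply: le_integrable H => //.
  by apply/measurable_EFinP; apply: measurable_funTS; exact: measurable_speed.
move=> x _ /=; rewrite sumEFin -EFinD lee_fin !ger0_norm.
- by rewrite lerD2l enorm_le_sum.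
- by rewrite addr_ge0 ?(ltW eps0)// enorm_ge0.
- by rewrite addr_ge0 ?(ltW eps0)//; apply: sumr_ge0 => i _; exact: normr_ge0.
Qed.

(** The set from which [arc_t] picks a value is nonempty by the intermediate value
   theorem. *)
Lemma is_arc_arc_t : is_arc a b eps speed (arc_t a b eps F).
Proof.
have sE x : x <= b -> arc_s a b eps F x = arc_len a speed x := @arc_s_speed x.
have sa : arc_len a speed a = 0 by rewrite /arc_len set_itvoo0 Rintegral_set0.
have L0 : 0 <= arc_len a speed b.
  by apply: Rintegral_ge0 => x _; rewrite addr_ge0 ?(ltW eps0)// enorm_ge0.
split.
- exact: measurable_speed.
- by move=> x; rewrite lerDl enorm_ge0.
- exact: integrable_speed.
- split => y; rewrite /arc_t.
  + by move=> ->.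
  + by move=> Ly; rewrite ltNge (le_trans L0 (ltW Ly))/= sE// Ly.
  + move=> y0 yL; rewrite ltNge y0/= sE// ltNge yL/=.
    have [c cab cy] : exists2 c, c \in `[a, b] & arc_len a speed c = y.
      apply: (IVT (ltW ab) (continuous_primitive (ltW ab) integrable_speed)).
      by rewrite -/(arc_len a speed a) -/(arc_len a speed b) sa (min_l L0) (max_r L0) y0.
    have := @xgetPex _ a [set x | x \in `[a, b] /\ arc_s a b eps F x = y].
    case; first by exists c; split => //; rewrite sE//; move: cab; rewrite in_itv/= => /andP[].
    move=> xab E; have := xab; rewrite in_itv/= => /andP[ax xb].
    by rewrite ax xb -sE.
Qed.

End one_curve.
End curve.

(** * Convergence of reparameterized curves *)

Lemma real_rVE (R : realType) (s : R -> R) y i : real_rV s y 0 i = s y.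
Proof. by rewrite mxE. Qed.

Section curve_limit.
Context {R : realType} {N : nat}.
Notation mu := (@lebesgue_measure R).
Variables (a b p : R).
Hypotheses (ab : a < b) (p1 : 1 <= p).
Notation J := `]a, b[%classic.
Variables (F_ : nat -> R -> 'rV[R]_N) (F : R -> 'rV[R]_N).
Hypotheses (cF_ : forall n i, {within `[a, b], continuous (fun x => F_ n x 0 i)})
           (cF : forall i, {within `[a, b], continuous (fun x => F x 0 i)}).
Hypothesis FF : W1q_cvg J p F_ F.

Let WF_ n : in_W1q J p (F_ n). Proof. by case: FF. Qed.
Let WF : in_W1q J p F. Proof. by case: FF. Qed.
Let U n x := F_ n x - F x.
Let w_ n := velocity a b (F_ n).
Let w := velocity a b F.
Let W n x := w_ n x - w x.

Let WE n x i : W n x 0 i = w_ n x 0 i - w x 0 i.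
Proof. by rewrite !mxE. Qed.

Let cU n i : {within `[a, b], continuous (fun x => U n x 0 i)}.
Proof.
rewrite (_ : (fun x => _) = (fun x => F_ n x 0 i - F x 0 i)); last first.
  by apply/funext => x; rewrite !mxE.
by move=> x; apply: cvgB; [exact: (@cF_ n i)|exact: (@cF i)].
Qed.

Let iW n i : mu.-integrable J (EFin \o (fun x => W n x 0 i)).
Proof.
rewrite (_ : (fun x => W n x 0 i) = (fun x => w_ n x 0 i - w x 0 i)); last first.
  by apply/funext => x; rewrite !mxE.
apply: integrable_subR => //.
- exact: (velocity_integrable ab p1 (@cF_ n) (WF_ n)).
- exact: (velocity_integrable ab p1 cF WF).
Qed.

Let mW n i : measurable_fun [set: R] (fun x => W n x 0 i).
Proof.
rewrite (_ : (fun x => W n x 0 i) = (fun x => w_ n x 0 i - w x 0 i)); last first.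
  by apply/funext => x; rewrite !mxE.
apply: measurable_funB.
- exact: (measurable_velocity (WF_ n)).
- exact: (measurable_velocity WF).
Qed.

Let UW n i x y : a <= y -> y <= x -> x <= b ->
  U n x 0 i - U n y 0 i = \int[mu]_(z in `]y, x[) W n z 0 i.
Proof.
move=> ay yx xb.
have -> : U n x 0 i - U n y 0 i = (F_ n x 0 i - F_ n y 0 i) - (F x 0 i - F y 0 i).
  by rewrite !mxE; ring.
rewrite (velocity_primitive ab p1 (@cF_ n) (WF_ n) i ay yx xb).
rewrite (velocity_primitive ab p1 cF WF i ay yx xb).
have sub : `]y, x[ `<=` `]a, b[ by apply: subset_itv; rewrite bnd_simp.
have i1 : mu.-integrable `]y, x[ (EFin \o (fun x => w_ n x 0 i)).
  by apply: integrableS (velocity_integrable ab p1 (@cF_ n) (WF_ n) i).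
have i2 : mu.-integrable `]y, x[ (EFin \o (fun x => w x 0 i)).
  by apply: integrableS (velocity_integrable ab p1 cF WF i).
by rewrite -RintegralB//; apply: eq_Rintegral => z _; rewrite !mxE.
Qed.

Let UWderiv n : is_weak_deriv J (U n) (W n).
Proof.
move=> i; apply: (weak_of_primitive ab); first exact: iW.
by move=> x y ay yx xb; apply: UW => //; exact: ltW.
Qed.

Let muJ : (mu J <= (b - a)%:E)%E.
Proof. by rewrite /= lebesgue_measure_itv/= lte_fin ab -EFinD. Qed.

Let near_norm (e : R) : 0 < e -> \forall n \near \oo, (W1q_norm J p (U n) <= e%:E)%E.
Proof. by move=> e0; apply: cvge0_le => //; case: FF. Qed.

Let L1_le (e : R) (u : nat -> R -> 'rV[R]_N) : 0 < e ->
  (forall n i, measurable_fun J (fun x => u n x 0 i)) ->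
  (forall n, Lq_norm J p (u n) <= W1q_norm J p (U n))%E ->
  forall i, \forall n \near \oo, (\int[mu]_(x in J) `|u n x 0 i|%:E <= e%:E)%E.
Proof.
move=> e0 mu_ uN i; have l0 : 0 < b - a + 1 by rewrite ltr_wpDl// subr_ge0 ltW.
apply: filterS (near_norm (divr_gt0 e0 l0)) => n Hn.
have := Lq_to_L1 (measurable_itv _) muJ p1 (divr_gt0 e0 l0) (@mu_ n) (le_trans (uN n) Hn).
rewrite divfK ?gt_eqF// => H; apply: le_trans H.
apply: ge0_le_integral => //.
- by apply/measurable_EFinP; apply: measurableT_comp => //; exact: mu_.
- by apply/measurable_EFinP; exact: measurable_enorm.
- by move=> x _; rewrite lee_fin comp_le_enorm.
Qed.

(** The difference of the velocities is almost everywhere the weak derivative of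
   the difference, to which the W^{1,p} norm refers. *)
Lemma velocity_cvg i (e : R) : 0 < e -> \forall n \near \oo,
  (\int[mu]_(x in J) `|w_ n x 0 i - w x 0 i|%:E <= e%:E)%E.
Proof.
move=> e0; have pN0 : p != 0 by rewrite gt_eqF// (lt_le_trans ltr01).
have := @L1_le e W e0.
have H1 n j : measurable_fun J (fun x => W n x 0 j) by exact: measurable_funTS.
move=> /(_ H1) H2.
suff /H2/(_ i) : forall n, (Lq_norm J p (W n) <= W1q_norm J p (U n))%E.
  by apply: filterS => n; under eq_integral do rewrite WE.
move=> n; rewrite /W1q_norm.
have wd := weak_derivP (UWderiv n).
rewrite -(@eq_ae_Lq_norm _ _ J p (weak_deriv J (U n)) (W n))//.
- by rewrite leeDr// Lnorm_ge0.
- by move=> j; have [[]] := wd j.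
- apply: (weak_deriv_unique _ (UWderiv n)) => j x xab.
  exact: (within_continuous_continuous ab (@cU n j) xab).
Qed.

(** For the difference U of two curves, |U x| <= |U y| + int |U'| for all y; averaging over
   y gives (b - a) |U x| <= int |U| + (b - a) int |U'|. *)
Lemma curve_cvg i (e : R) : 0 < e -> \forall n \near \oo,
  forall x, a <= x <= b -> `|F_ n x 0 i - F x 0 i| <= e.
Proof.
move=> e0; have ba0 : 0 < b - a by rewrite subr_gt0.
have e20 : 0 < e / 2 by rewrite divr_gt0.
have mU n j : measurable_fun J (fun x => U n x 0 j).
  have [[mF _] _] := WF; have [[mFn _] _] := WF_ n.
  have := measurable_funB (mFn j) (mF j).
  by apply: eq_measurable_fun => x _; rewrite !mxE.
have near1 := L1_le (mulr_gt0 e20 ba0) mU (fun n => leeDl _ (Lnorm_ge0 _ _ _)) i.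
near=> n => x xab.
have HU : (\int[mu]_(x in J) `|U n x 0 i|%:E <= (e / 2 * (b - a))%:E)%E by near: n.
have HW : (\int[mu]_(x in J) `|W n x 0 i|%:E <= (e / 2)%:E)%E.
  under eq_integral do rewrite WE.
  by near: n; exact: velocity_cvg.
have -> : F_ n x 0 i - F x 0 i = U n x 0 i by rewrite !mxE.
(* The increments of U n are at most the L^1 norm of its derivative. *)
have osc s t : a <= t -> t <= s -> s <= b -> `|U n s 0 i - U n t 0 i| <= e / 2.
  move=> at_ ts sb; rewrite UW//.
  have sub : `]t, s[ `<=` `]a, b[ by apply: subset_itv; rewrite bnd_simp.
  have its : mu.-integrable `]t, s[ (EFin \o (fun x => W n x 0 i)) by apply: integrableS (iW n i).
  apply: le_trans (le_normr_Rintegral _ its) _ => //.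
  rewrite -lee_fin EFin_Rintegral//; last exact: integrable_norm its.
  apply: le_trans HW; apply: ge0_subset_integral => //.
  by apply/measurable_EFinP; apply: measurable_funTS; apply: measurableT_comp => //; exact: mW.
have key y : J y -> `|U n x 0 i| <= `|U n y 0 i| + e / 2.
  rewrite /= in_itv/= => /andP[/ltW ay /ltW yb]; have /andP[ax xb] := xab.
  have H : `|U n x 0 i - U n y 0 i| <= e / 2.
    by have [yx|/ltW xy] := leP y x; [exact: osc|rewrite distrC; exact: osc].
  rewrite -[X in `|X|](subrK (U n y 0 i)) (le_trans (ler_normD _ _))//.
  by rewrite addrC lerD2l.
have I : (\int[mu]_(y in J) (cst (`|U n x 0 i|%:E) y) <=
   \int[mu]_(y in J) (`|U n y 0 i|%:E + (cst (e / 2)%:E y)))%E.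
  apply: ge0_le_integral => //.
  - by move=> y _ /=; rewrite lee_fin.
  - apply: emeasurable_funD => //; apply/measurable_EFinP; apply: measurableT_comp => //.
    exact: mU.
have muJE : mu J = (b - a)%:E by rewrite /= lebesgue_measure_itv/= lte_fin ab -EFinD.
move: I; rewrite ge0_integralD//; last 2 first.
- by apply/measurable_EFinP; apply: measurableT_comp => //; exact: mU.
- by move=> y _; rewrite lee_fin ltW.
rewrite !integral_cst//= muJE -!EFinM => I.
have := le_trans I (leeD HU (lexx _)); rewrite -EFinD lee_fin -mulrDl -splitr.
by rewrite ler_pM2r.
Unshelve. all: by end_near. Qed.

Lemma speed_cvg (eps e : R) : 0 < e -> \forall n \near \oo,
  (\int[mu]_(x in J) `|speed a b (F_ n) eps x - speed a b F eps x|%:E <= e%:E)%E.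
Proof.
move=> e0; have N1 : 0 < N%:R + 1 :> R by rewrite ltr_wpDl.
have e1 : 0 < e / (1 * (N%:R + 1)) by rewrite mul1r divr_gt0.
have H : \forall n \near \oo, forall i,
    (\int[mu]_(x in J) `|w_ n x 0 i - w x 0 i|%:E <= (e / (1 * (N%:R + 1)))%:E)%E.
  by apply: filter_forall => i; exact: velocity_cvg.
apply: filterS H => n Hn.
have mi i : measurable_fun J (fun x => `|w_ n x 0 i - w x 0 i|%:E).
  apply/measurable_EFinP; apply: measurableT_comp => //; apply: measurable_funTS.
  by have := mW n i; apply: eq_measurable_fun => x _; rewrite !mxE.
apply: (@le_trans _ _ (\int[mu]_(x in J) (\sum_(i < N) `|w_ n x 0 i - w x 0 i|%:E))%E).
  apply: ge0_le_integral => //.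
  - apply/measurable_EFinP; apply: measurable_funTS; apply: measurableT_comp => //.
    by apply: measurable_funB; [exact: (measurable_speed (WF_ n))|exact: (measurable_speed WF)].
  - by apply: emeasurable_sum => i; exact: mi.
  - move=> x _; rewrite sumEFin lee_fin /speed opprD addrACA subrr add0r.
    exact: enorm_diff_le.
rewrite ge0_integral_sum//; apply: (@le_trans _ _ (\sum_(i < N) (e / (1 * (N%:R + 1)))%:E)%E).
  by apply: lee_sum => i _.
rewrite sumEFin sumr_const card_ord lee_fin -[leLHS]mulr_natl.
by have := @mul_frac_le R N%:R e 1 (ler0n _ _) e0 ltr01; rewrite divr1.
Qed.

Variables (eps q : R).
Hypotheses (eps0 : 0 < eps) (q1 : 1 <= q).
Let t_ n := arc_t a b eps (F_ n).
Let t := arc_t a b eps F.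
Let g_ n := speed a b (F_ n) eps.
Let g := speed a b F eps.

Let A_ n : is_arc a b eps (g_ n) (t_ n) := is_arc_arc_t ab p1 (@cF_ n) (WF_ n) eps0.
Let A : is_arc a b eps g t := is_arc_arc_t ab p1 cF WF eps0.

(** The case G = id of the limit theorems: w = 1, and 1 <= (1 / eps) g. *)
Lemma reparam_cvg : W1q_loc_cvg q (fun n => real_rV (t_ n)) (real_rV t).
Proof.
pose one : R -> R := cst 1.
have m1 : measurable_fun [set: R] one by [].
have oneM h s x : is_arc a b eps h s -> `|one x| <= eps^-1 * h x.
  by case=> _ hge _ _; rewrite normr1 mulrC ler_pdivlMr// mul1r.
have id1 (x y : R) : a <= y -> y <= x -> x <= b -> id x - id y = \int[mu]_(z in `]y, x[) one z.
  move=> _ yx _; rewrite Rintegral_cst//= lebesgue_measure_itv/= lte_fin mul1r.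
  by move: yx; rewrite le_eqVlt => /predU1P[->|->//]; rewrite ltxx subrr.
have br h s : is_arc a b eps h s ->
    bounded_rate eps^-1 (real_rV s) (real_rV (arc_rate a b h s one)).
  move=> B; split => [i|i x|i x y yx].
  - have := arc_rate_measurable ab eps0 B m1.
    by apply: eq_measurable_fun => x _; rewrite mxE.
  - by rewrite mxE; apply: (arc_rate_le eps0 B) => z; exact: oneM B.
  - rewrite !mxE; have := arc_rate_primitive ab eps0 B m1 (fun z => oneM _ _ z B) id1 yx.
    by move=> ->; apply: eq_Rintegral => z _; rewrite mxE.
apply: (W1q_loc_cvg_bounded_rate q1 (fun n => br _ _ (A_ n)) (br _ _ A)) => i e e0.
  apply: filterS (arc_inv_cvg ab eps0 A_ A (@speed_cvg eps) e0) => n H y.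
  by move: (H y); rewrite -[t_ n y](real_rVE _ _ i) -[t y](real_rVE _ _ i).
have one_cvg (e' : R) : 0 < e' -> \forall n \near \oo,
    (\int[mu]_(x in J) `|one x - one x|%:E <= e'%:E)%E.
  by move=> e'0; near=> n; rewrite integral0_eq ?lee_fin ?ltW// => x _; rewrite subrr normr0.
have := @arc_rate_cvg R a b eps ab eps0 g_ t_ g t A_ A (@speed_cvg eps) (fun=> one) one eps^-1
  (fun=> m1) m1 (fun n x => oneM _ _ x (A_ n)) (fun x => oneM _ _ x A) one_cvg e e0.
apply: filterS => n H; apply: (le_trans _ H).
rewrite le_eqVlt; apply/orP; left; apply/eqP; apply: eq_integral => y _.
by congr (`|_ - _|%:E); exact: real_rVE.
Unshelve. all: by end_near. Qed.

(** The limit theorems for G a component of F: w is that component of the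
   velocity, which is at most g. *)
Lemma curve_reparam_cvg :
  W1q_loc_cvg q (fun n y => F_ n (t_ n y)) (fun y => F (t y)).
Proof.
have wM (Fc : R -> 'rV[R]_N) i x : `|velocity a b Fc x 0 i| <= 1 * speed a b Fc eps x.
  by rewrite mul1r (le_trans (comp_le_enorm _ i))// lerDr ltW.
pose r Fc s y : 'rV[R]_N := \row_i arc_rate a b (speed a b Fc eps) s (fun x => velocity a b Fc x 0 i) y.
have br (Fc : R -> 'rV[R]_N) s : (forall i, {within `[a, b], continuous (fun x => Fc x 0 i)}) ->
    in_W1q J p Fc -> is_arc a b eps (speed a b Fc eps) s ->
    bounded_rate 1 (fun y => Fc (s y)) (r Fc s).
  move=> cFc WFc B; split => [i|i x|i x y yx].
  - have := arc_rate_measurable ab eps0 B (measurable_velocity WFc i).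
    by apply: eq_measurable_fun => x _; rewrite mxE.
  - by rewrite mxE; apply: (arc_rate_le eps0 B) => z; exact: wM.
  - have := arc_rate_primitive ab eps0 B (measurable_velocity WFc i) (wM Fc i)
      (velocity_primitive ab p1 cFc WFc i) yx.
    by move=> ->; apply: eq_Rintegral => z _; rewrite mxE.
apply: (W1q_loc_cvg_bounded_rate q1 (fun n => br _ _ (@cF_ n) (WF_ n) (A_ n)) (br _ _ cF WF A)) => i e e0.
  apply: (@arc_comp_cvg R a b eps ab eps0 g_ t_ g t A_ A (@speed_cvg eps)
    (fun n x => F_ n x 0 i) (fun x => w x 0 i) (fun x => F x 0 i) 1) => //.
  - exact: (measurable_velocity WF).
  - by move=> x; exact: wM.
  - exact: (velocity_primitive ab p1 cF WF).
  - exact: curve_cvg.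
have rE Fc s y : r Fc s y 0 i =
    arc_rate a b (speed a b Fc eps) s (fun x => velocity a b Fc x 0 i) y.
  by rewrite mxE.
have := @arc_rate_cvg R a b eps ab eps0 g_ t_ g t A_ A (@speed_cvg eps)
  (fun n x => w_ n x 0 i) (fun x => w x 0 i) 1
  (fun n => measurable_velocity (WF_ n) i) (measurable_velocity WF i)
  (fun n => wM (F_ n) i) (wM F i) (velocity_cvg i) e e0.
apply: filterS => n H; apply: (le_trans _ H).
rewrite le_eqVlt; apply/orP; left; apply/eqP; apply: eq_integral => y _.
by congr (`|_ - _|%:E); exact: rE.
Qed.

End curve_limit.

(** * Curves of multiple points *)

(** Absolute continuity for a single interval is uniform continuity, and Delta
   does not increase distances. *)
Lemma AQ_abs_continuous_comp (R : realType) (Q m N : nat) (a b : R)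
    (Delta : AQ R Q m -> 'rV[R]_N) (f : R -> AQ R Q m) :
  (forall S T, enorm (Delta S - Delta T) <= d2 S T) -> AQ_abs_continuous a b f ->
  forall i, {within `[a, b], continuous (fun x => Delta (f x) 0 i)}.
Proof.
move=> lip ac i; apply/subspace_continuousP => x /=; rewrite in_itv/= => /andP[ax xb].
apply/cvgrPdist_le => e e0.
have [d d0 Hd] := ac e e0.
have close l r : a <= l -> l <= r -> r <= b -> r - l < d ->
    `|Delta (f l) 0 i - Delta (f r) 0 i| <= e.
  move=> al lr rb lrd.
  have := Hd 1%N (fun=> l) (fun=> r).
  rewrite !big_ord1 => H; have {}H := H _ _ lrd.
  apply: (@le_trans _ _ (d2 (f l) (f r))); last first.
    apply: ltW; apply: H => //.
    by move=> j k _ _ _; rewrite (ord1 j) (ord1 k).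
  apply: le_trans (lip _ _).
  by have := comp_le_enorm (Delta (f l) - Delta (f r)) i; rewrite !mxE.
rewrite near_withinE; near=> y => /=; rewrite in_itv/= => /andP[ay yb].
have xyd : `|x - y| < d by near: y; exact: cvgr_dist_lt.
have [yx|/ltW xy] := leP y x.
  rewrite distrC; apply: close => //.
  by rewrite (le_lt_trans (ler_norm _)).
by apply: close => //; rewrite (le_lt_trans (ler_norm _))// distrC.
Unshelve. all: by end_near. Qed.

Unset Implicit Arguments.
Theorem theorem3p3 (R : realType) (Q m N : nat) (a b p eps : R)
    (Delta : AQ R Q m -> 'rV[R]_N)
    (f_ : nat -> R -> AQ R Q m) (f : R -> AQ R Q m)
    (hQ : (1 <= Q)%N) (hm : (1 <= m)%N) (hab : a < b) (heps : 0 < eps)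
    (hDelta : almgren_embedding Delta)
    (hf_ac : forall n, AQ_abs_continuous a b (f_ n))
    (hfac : AQ_abs_continuous a b f)
    (hcvg : (1 < p /\ AQ_W1q_cvg Delta `]a, b[%classic p f_ f) \/
            (AQ_W1q_cvg Delta `]a, b[%classic 1 f_ f /\
             exists2 x0 : R, x0 \in `[a, b] &
               d2 (f_ n x0) (f x0) @[n --> \oo] --> (0 : R))) :
  let t := arc_t a b eps (Delta \o f) in
  let t_ n := arc_t a b eps (Delta \o f_ n) in
  forall q : R, 1 <= q ->
    W1q_loc_cvg q (fun n => real_rV (t_ n)) (real_rV t) /\
    AQ_W1q_loc_cvg Delta q (fun n => f_ n \o t_ n) (f \o t).
Proof.
move=> t t_ q q1.
have [_ lip _ _] := hDelta.
have cF_ n := AQ_abs_continuous_comp lip (hf_ac n).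
have cF := AQ_abs_continuous_comp lip hfac.
have [r r1 cvg] : exists2 r : R, 1 <= r & AQ_W1q_cvg Delta `]a, b[%classic r f_ f.
  by case: hcvg => [[/ltW p1 H]|[H _]]; [exists p|exists 1].
split.
- exact: (reparam_cvg hab r1 cF_ cF cvg heps q1).
- exact: (curve_reparam_cvg hab r1 cF_ cF cvg heps q1).
Qed.
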